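(* For all $n\geq2$ and $1\leq k<d$, $\mathcal{H}_{n,k}$ points are detectable in $\mathcal{H}_{n,d}$; that is, there exist a constant $\phi>0$ and a function $\Phi:(0,1)\to(0,\infty)$ with $\liminf_{s\to0+}\Phi(s)=0$ such that if $S\in\mathcal{H}_{n,d}$, $r>0$ and $\Theta_S^{\mathcal{H}_{n,k}}(0,r)<\phi$, then $\Theta_S^{\mathcal{H}_{n,k}}(0,sr)<\Phi(s)$ for all $s\in(0,1)$.
   Context: For a polynomial $p:\mathbb{R}^n\to\mathbb{R}$, $\Sigma_p=\{x:p(x)=0\}$. $\mathcal{H}_{n,d}$ is the collection of all zero sets $\Sigma_p$ of nonconstant harmonic polynomials $p:\mathbb{R}^n\to\mathbb{R}$ of degree at most $d$ with $p(0)=0$. $B(x,r)$ is the open ball. For a nonempty set $A\subseteq\mathbb{R}^n$, $x\in A$, $r>0$, $$\Theta^{\mathcal{H}_{n,k}}_A(x,r)=\frac1r\inf_{S\in\mathcal{H}_{n,k}}\max\Big\{\sup_{a\in A\cap B(x,r)}\operatorname{dist}(a,x+S),\ \sup_{z\in(x+S)\cap B(x,r)}\operatorname{dist}(z,A)\Big\}.$$ *)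

(* Defs.v *)
From mathcomp Require Import all_boot all_order all_algebra.
From mathcomp Require Import all_classical all_reals all_analysis.
(* The notations of [mpoly] clash with those of mathcomp-analysis. *)
From mathcomp Require Import (canonicals, coercions) mpoly.
Import Order.TTheory GRing.Theory Num.Theory.
Import numFieldNormedType.Exports.

Set Implicit Arguments.
Unset Strict Implicit.
Unset Printing Implicit Defensive.

Local Open Scope classical_set_scope.
Local Open Scope ring_scope.

(* The norm that the library puts on ['rV[R]_n] is the sup norm, hence the
   explicit Euclidean norm and balls. *)
Definition l2norm (R : realType) (n : nat) (x : 'rV[R]_n) : R :=
  Num.sqrt (\sum_(i < n) x 0 i ^+ 2).

Definition l2ball (R : realType) (n : nat) (x : 'rV[R]_n) (r : R) :
    set 'rV[R]_n :=
  [set y | l2norm (y - x) < r].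

Definition l2dist (R : realType) (n : nat) (x : 'rV[R]_n)
    (A : set 'rV[R]_n) : R :=
  inf [set l2norm (x - a) | a in A].

Definition translate (R : realType) (n : nat) (x : 'rV[R]_n)
    (S : set 'rV[R]_n) : set 'rV[R]_n :=
  [set x + y | y in S].

Definition peval (R : realType) (n : nat) (p : mpoly.mpoly n R)
    (x : 'rV[R]_n) : R :=
  mpoly.meval (fun i => x 0 i) p.

Definition laplacian (R : realType) (n : nat) (p : mpoly.mpoly n R) :
    mpoly.mpoly n R :=
  \sum_(i < n) mpoly.mderiv i (mpoly.mderiv i p).

Definition zero_set (R : realType) (n : nat) (p : mpoly.mpoly n R) :
    set 'rV[R]_n :=
  [set x | peval p x = 0].

(* [mpoly.msize p] is the total degree of [p] plus one (and 0 if [p = 0]). *)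
Definition harmonic_zero_sets (R : realType) (n d : nat) :
    set (set 'rV[R]_n) :=
  [set zero_set p | p in [set p : mpoly.mpoly n R |
     [/\ forall c : R, p <> mpoly.mpolyC n c,
         laplacian p = 0,
         (mpoly.msize p <= d.+1)%N
       & peval p 0 = 0]]].
Arguments harmonic_zero_sets : clear implicits.

(* When [x] is in [A], [0 < r], [T] is nonempty and every [S] in [T]
   contains 0, the two suprema are over nonempty subsets of [0, r[ and the
   infimum is over a nonempty set of nonnegative reals; the defaults of [sup]
   and [inf] for other sets then play no role. *)
Definition Theta (R : realType) (n : nat) (T : set (set 'rV[R]_n))
    (A : set 'rV[R]_n) (x : 'rV[R]_n) (r : R) : R :=
  r^-1 * inf [set Num.max
      (sup [set l2dist a (translate x S) | a in A `&` l2ball x r])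
      (sup [set l2dist z A | z in translate x S `&` l2ball x r])
    | S in T].

(* The function from (0, 1) to (0, +oo) is a total [Phi : R -> R]
   of which only the values on (0, 1) are used. *)
Definition detectable (R : realType) (n : nat) (T U : set (set 'rV[R]_n)) :
    Prop :=
  exists (phi : R) (Phi : R -> R),
    [/\ 0 < phi,
        forall s : R, 0 < s < 1 -> 0 < Phi s,
        limf_einf (fun s => (Phi s)%:E) (0 : R)^'+ = 0%E
      & forall (S : set 'rV[R]_n) (r : R), U S -> 0 < r ->
          Theta T S 0 r < phi ->
          forall s : R, 0 < s < 1 -> Theta T S 0 (s * r) < Phi s].

(* Main.v *)
Require Import Defs.
From mathcomp Require Import all_boot all_order all_algebra.
From mathcomp Require Import all_classical all_reals all_analysis.
From mathcomp Require Import (canonicals, coercions) mpoly.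
From mathcomp Require Import ring lra zify.
Import Order.TTheory GRing.Theory Num.Theory.
Import numFieldNormedType.Exports.

Set Implicit Arguments.
Unset Strict Implicit.
Unset Printing Implicit Defensive.

Local Open Scope classical_set_scope.
Local Open Scope ring_scope.

(** Why the theorem holds.

    Let [p] be harmonic of degree at most [d] with [p(0) = 0], and call the
    sum of its terms of degree at most [k] its low part. Two facts carry the
    proof. If, in the unit ball, the zeros of [p] are close enough to those of
    a harmonic polynomial of degree at most [k] vanishing at 0, then the low
    part holds a fixed proportion of the coefficients of [p]
    ([low_part_dominates]). Conversely, once the low part holds such a
    proportion, passing from [p] to [p(s x)] damps the high part by a further
    factor [s] relative to the low part, so the dilated polynomial, and with it
    its zero set, approaches those of degree at most [k], uniformly in [p]
    ([low_part_detectable]). All notions commute with dilations, so a ball of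
    radius [r] reduces to the unit ball. One can then take for [Phi s] the sum
    of [s] and of the supremum of all the values of [Theta] at scale [s * r]
    that the hypothesis allows: these are at most 1 and tend to 0 with [s].

    Both facts are compactness arguments by contradiction. Normalized
    polynomials of bounded degree converge coefficientwise along an
    ultrafilter, harmonicity passes to the limit, and zero sets converge
    locally, because a nonzero harmonic polynomial takes both signs near each
    of its zeros ([sign_change]).

    For the first fact the limit is a pair of nonzero harmonic polynomials:
    [P], which vanishes to order greater than [k] at 0, and [Q], of degree at
    most [k] with [Q(0) = 0], such that all zeros of [P] in the unit ball are
    zeros of [Q]. Taking lowest-order parts at 0 produces homogeneous harmonic
    [p] and [q] of degrees [j > m] such that the zeros of [p] are zeros of [q].
    That this is absurd ([homog_zeros_not_included]) is the heart of the proof.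
    Let [N = x.grad - Laplacian], so that [N p = j p] and [N q = m q]. On the
    region where [p > 0] and [q > 0], [q] vanishes on the boundary and is an
    eigenfunction for [m], while [p] is a positive supersolution for the larger
    number [j]; this contradicts the uniqueness of the ground state. The
    boundary may be singular, so Green's formula is avoided and the maximum
    principle is applied to the quotient of [q] by
    [F = K p + 2 W + A - sum_i H(u_i)]. Here [W] is a sum of high even powers
    of the coordinates, which controls infinity, and the last sum handles the
    zero set of [p], where [p] itself is of no help: the [u_i] are iterated
    derivatives of [p], and [H] is a Huber function with a tiny parameter,
    which is bounded by [|u_i| + 1] but has a huge Laplacian where [u_i] is
    tiny and its gradient is not. At every zero of [p] some derivative in a
    suitable chain behaves in this way ([derivative_chain]). Hence
    [N F > m F] everywhere on the region, which is impossible at a maximum of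
    the quotient. The same barrier proves [sign_change]. *)

(** * Polynomials through their coefficients *)
Local Notation mon := mpoly.multinom.
Local Notation mdeg := mpoly.mdeg.
Local Notation cf := mpoly.mcoeff.
Local Notation U_ := mpoly.mnm1.
Local Notation addm := mpoly.mnm_add.

Section Coefficients.
Context {R : realType} {n : nat}.
Implicit Types (p q : mpoly.mpoly n R) (c : mon n -> R) (x : 'rV[R]_n).

Definition poly_of_coefs (D : nat) (c : mon n -> R) : mpoly.mpoly n R :=
  \sum_(m : mpoly.bmultinom n D) c m *: mpoly.mpolyX R m.

Lemma mcoeff_poly_of_coefs D c m :
  cf m (poly_of_coefs D c) = if (mdeg m < D)%N then c m else 0.
Proof.
case: ifPn => hm; first exact: mpoly.mcoeff_mpoly.
rewrite raddf_sum big1 // => -[i /= hi] _.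
rewrite mpoly.mcoeffZ mpoly.mcoeffX; case: eqP => [/= e|]; last by rewrite mulr0.
by rewrite -e hi in hm.
Qed.

Lemma msize_le_coef p D :
  reflect (forall m, (D <= mdeg m)%N -> cf m p = 0) (mpoly.msize p <= D)%N.
Proof.
apply: (iffP idP) => [hs m hm|h].
  by apply/mpoly.memN_msupp_eq0/mpoly.msize_mdeg_ge/(leq_trans hs).
rewrite mpoly.msizeE; apply/bigmax_leqP_seq => m hm _.
rewrite ltnNge; apply/negP => /h /eqP.
by rewrite mpoly.mcoeff_eq0 hm.
Qed.

Lemma msize_poly_of_coefs D c : (mpoly.msize (poly_of_coefs D c) <= D)%N.
Proof. by apply/msize_le_coef => m hm; rewrite mcoeff_poly_of_coefs ltnNge hm. Qed.

Lemma peval_sum p x D : (mpoly.msize p <= D)%N ->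
  peval p x =
  \sum_(m : mpoly.bmultinom n D) cf m p * \prod_(i < n) x 0 i ^+ (m : mon n) i.
Proof. by move=> hp; rewrite /peval /mpoly.meval (mpoly.mmapE D). Qed.

Lemma pevalD p q x : peval (p + q) x = peval p x + peval q x.
Proof. exact: mpoly.mevalD. Qed.
Lemma pevalN p x : peval (- p) x = - peval p x.
Proof. exact: mpoly.mevalN. Qed.
Lemma pevalB p q x : peval (p - q) x = peval p x - peval q x.
Proof. exact: mpoly.mevalB. Qed.
Lemma pevalM p q x : peval (p * q) x = peval p x * peval q x.
Proof. exact: mpoly.mevalM. Qed.
Lemma pevalZ (a : R) p x : peval (a *: p) x = a * peval p x.
Proof. exact: mpoly.mevalZ. Qed.
Lemma pevalC (a : R) x : peval (mpoly.mpolyC n a) x = a.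
Proof. exact: mpoly.mevalC. Qed.
Lemma peval0 x : peval (0 : mpoly.mpoly n R) x = 0.
Proof. exact: mpoly.meval0. Qed.
Lemma pevalU i x : peval (mpoly.mpolyX R (U_ i)) x = x 0 i.
Proof. exact: mpoly.mevalXU. Qed.
Lemma peval_sumE (I : Type) (r : seq I) (P : pred I) (F : I -> mpoly.mpoly n R) x :
  peval (\sum_(i <- r | P i) F i) x = \sum_(i <- r | P i) peval (F i) x.
Proof. exact: raddf_sum. Qed.

Lemma peval_at0 p : peval p 0 = cf (@mpoly.mnm0 n) p.
Proof.
rewrite (@peval_sum p 0 (mpoly.msize p).+1) //.
rewrite (bigD1 (mpoly.bm0 : mpoly.bmultinom n (mpoly.msize p).+1)) //=.
rewrite big1 ?mulr1 => [|i _]; last by rewrite mpoly.mnm0E expr0.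
rewrite big1 ?addr0 // => m hm.
have [i hi] : exists i, (m : mon n) i != 0%N.
  apply: contrapT => h; case/negP: hm; apply/eqP/val_inj/mpoly.mnmP => i /=.
  rewrite mpoly.mnm0E; apply/eqP; apply: contrapT => hi.
  by apply: h; exists i; apply/negP.
by rewrite (bigD1 i) //= mxE expr0n (negbTE hi) mul0r mulr0.
Qed.

Definition harmonic_poly p := laplacian p = 0.

(** Harmonicity as linear equations between coefficients of equal degree:
    in this form it visibly survives coefficientwise limits and weights that
    depend on the degree only. *)
Lemma harmonicP p : harmonic_poly p <-> forall m : mon n,
  \sum_(i < n) cf (addm (addm m (U_ i)) (U_ i)) p *+ (m i).+2 *+ (m i).+1 = 0.
Proof.
have E m : cf m (laplacian p) =
    \sum_(i < n) cf (addm (addm m (U_ i)) (U_ i)) p *+ (m i).+2 *+ (m i).+1.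
  rewrite /laplacian raddf_sum /=; apply: eq_bigr => i _.
  by rewrite !mpoly.mcoeff_deriv mpoly.mnmDE mpoly.mnm1E eqxx addn1.
split=> [h m|h]; first by rewrite -E h mpoly.mcoeff0.
by apply/mpoly.mpolyP => m; rewrite E h mpoly.mcoeff0.
Qed.

Lemma harmonic_degree_weight p q (w : nat -> R) :
  (forall m, cf m q = w (mdeg m) * cf m p) -> harmonic_poly p -> harmonic_poly q.
Proof.
move=> hw /harmonicP hp; apply/harmonicP => m.
transitivity (w (mdeg m).+2 * 0); last by rewrite mulr0.
rewrite -[in RHS](hp m) mulr_sumr; apply: eq_bigr => i _.
by rewrite hw -!mulrnAr !mpoly.mdegD mpoly.mdeg1 !addn1.
Qed.

Lemma neq0_coef p : p != 0 -> exists m, cf m p != 0.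
Proof.
move=> hp; apply: contrapT => h; case/negP: hp; apply/eqP/mpoly.mpolyP => m.
rewrite mpoly.mcoeff0; apply/eqP; apply: contrapT => hm.
by apply: h; exists m; apply/negP.
Qed.

(** The degree bound makes evaluation a finite sum with a fixed index set,
    so that the polynomial and the point may vary at the same time. *)
Lemma cvg_peval (I : Type) (F : set_system I) {FF : Filter F} (D : nat)
    (ps : I -> mpoly.mpoly n R) p (xs : I -> 'rV[R]_n) x :
  (forall i, (mpoly.msize (ps i) <= D)%N) -> (mpoly.msize p <= D)%N ->
  (forall m, cf m (ps i) @[i --> F] --> cf m p) -> xs @ F --> x ->
  peval (ps i) (xs i) @[i --> F] --> peval p x.
Proof.
move=> hD hp hc hx.
under eq_fun do rewrite (peval_sum _ (hD _)).
rewrite (peval_sum _ hp).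
apply: cvg_big => [|m _]; first exact: add_continuous.
apply: (@cvgM _ _ _ _ (fun i => cf m (ps i))
  (fun i => \prod_(j < n) xs i 0 j ^+ (m : mon n) j)); first exact: hc.
apply: cvg_big => [|j _]; first exact: mul_continuous.
apply: (continuous_cvg _ (@exprn_continuous _ _ _)).
exact: (continuous_cvg _ (@coord_continuous _ _ _ 0 j x)).
Qed.

Lemma peval_continuous p : continuous (peval p).
Proof.
move=> x.
apply: (@cvg_peval _ (nbhs x) (nbhs_filter x) (mpoly.msize p) (fun=> p) p id x).
- by [].
- by [].
- by move=> m; exact: cvg_cst.
- exact: cvg_id.
Qed.

End Coefficients.


(** * Second-order conditions at a local maximum *)
Section LocalMaximum.
Context {R : realType}.

Lemma poly_local_max (l : {poly R}) (e : R) : 0 < e ->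
  (forall t, `|t| < e -> l.[t] <= l.[0]) ->
  (deriv l).[0] = 0 /\ (deriv (deriv l)).[0] <= 0.
Proof.
have dec (p : {poly R}) : exists r a, p = r * 'X + a%:P.
  by elim/poly_ind: p => [|p c _]; [exists 0, 0; rewrite mul0r add0r | exists p, c].
move=> e0 hl.
have [r1 [a ea]] := dec l; have [r2 [b eb]] := dec r1; have [r3 [c ec]] := dec r2.
have E t : l.[t] - l.[0] = t * (b + t * (c + t * r3.[t])).
  by rewrite ea eb ec !hornerE; ring.
have D1 : (deriv l).[0] = b.
  by rewrite ea eb ec !poly.derivE !hornerE /=; ring.
have D2 : (deriv (deriv l)).[0] = c *+ 2.
  by rewrite ea eb ec !poly.derivE !hornerE /=; ring.
have b0 : b = 0.
  have [C hC] := poly_disk_bound (r3 * 'X + c%:P) 1.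
  have C0 : 0 <= C by apply: le_trans (hC 0 _); rewrite ?normr_ge0 ?normr0.
  apply: contrapT => /eqP nb.
  have nb0 : 0 < `|b| by rewrite normr_gt0.
  (* a step proportional to the slope b treats both signs of b at once;
     eta makes it short enough for the higher order terms not to matter *)
  pose eta := (1 + C + `|b| + `|b| / e)^-1.
  have be0 : 0 < `|b| / e by rewrite divr_gt0.
  have den : 0 < 1 + C + `|b| + `|b| / e by lra.
  have eta0 : 0 < eta by rewrite invr_gt0.
  have h1 : eta * `|b| < e.
    rewrite /eta mulrC ltr_pdivrMr // mulrC -ltr_pdivrMr //; lra.
  have h2 : eta * `|b| <= 1.
    rewrite /eta mulrC ler_pdivrMr //; lra.
  have h3 : eta * C * `|b| < 1 * `|b|.
    by rewrite ltr_pM2r // /eta mulrC ltr_pdivrMr //; lra.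
  pose t := eta * b.
  have nt : `|t| = eta * `|b| by rewrite normrM gtr0_norm.
  have := hl t; rewrite nt => /(_ h1); rewrite -subr_le0 E.
  have := hC t; rewrite nt => /(_ h2); rewrite hornerD hornerM hornerX hornerC => hs.
  set s := c + t * r3.[t].
  have hs' : `|s| <= C by rewrite (_ : s = r3.[t] * t + c) // /s; ring.
  have : - (t * s) <= eta * `|b| * C.
    rewrite -nt; apply: le_trans (ler_norm _) _; rewrite normrN normrM.
    by rewrite ler_wpM2l.
  move=> h4 h5.
  have h6 : 0 < b * (b + t * s).
    case: (ltrgtP b 0) nb => // hb _; last first.
      rewrite (gtr0_norm hb) in h3 h4; nra.
    have : t * s <= eta * `|b| * C.
      rewrite -nt; apply: le_trans (ler_norm _) _; rewrite normrM.
      by rewrite ler_wpM2l.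
    rewrite (ltr0_norm hb) in h3 h4 *; nra.
  move: h5; rewrite /t -mulrA pmulr_rle0 // -/t; lra.
split; first by rewrite D1.
rewrite D2; apply: contrapT => /negP; rewrite -ltNge pmulrn_lgt0 // => c0.
have [C hC] := poly_disk_bound r3 1.
have C0 : 0 <= C by apply: le_trans (hC 0 _); rewrite ?normr_ge0 ?normr0.
pose t := Num.min (Num.min 1 (e / 2)) (c / (C + 1) / 2).
have cC : 0 < c / (C + 1) by rewrite divr_gt0 //; lra.
have t0 : 0 < t by rewrite !lt_min ltr01 /= !divr_gt0 //; lra.
have t1 : t <= 1 by rewrite !ge_min lexx.
have te : t < e.
  by apply: (@le_lt_trans _ _ (e / 2)); [rewrite !ge_min lexx orbT | lra].
have tc : t * (C + 1) < c.
  rewrite -ltr_pdivlMr; last lra.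
  apply: (@le_lt_trans _ _ (c / (C + 1) / 2)); last lra.
  by rewrite !ge_min lexx orbT.
have := hl t; rewrite gtr0_norm // => /(_ te); rewrite -subr_le0 E b0 add0r.
have := hC t; rewrite gtr0_norm // => /(_ t1); rewrite ler_norml => /andP[hs _].
rewrite !pmulr_rle0 //; nra.
Qed.

Context {n : nat}.
Implicit Types (p g u : mpoly.mpoly n R) (x y : 'rV[R]_n).

Lemma mpoly_ring_ind (Q : mpoly.mpoly n R -> Prop) :
  (forall a, Q (mpoly.mpolyC n a)) -> (forall i, Q (mpoly.mpolyX R (mpoly.mnm1 i))) ->
  (forall p q, Q p -> Q q -> Q (p + q)) ->
  (forall p q, Q p -> Q q -> Q (p * q)) -> forall p, Q p.
Proof.
move=> hC hX hD hM p.
have hE k q : Q q -> Q (q ^+ k).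
  by move=> hq; elim: k => [|k ih]; [exact: hC | rewrite exprS; apply: hM].
elim/mpoly.mpolyind: p => [|c m p _ _ hp].
  by rewrite -mpoly.mpolyC0; exact: hC.
apply: hD => //; rewrite -mpoly.mul_mpolyC; apply: (hM) => //.
rewrite mpoly.mpolyXE_id; elim/big_ind: _ => [|p1 p2|i _]; [exact: hC|exact: hM|exact/hE/hX].
Qed.

Lemma mderivU (i k : 'I_n) :
  mpoly.mderiv i (mpoly.mpolyX R (mpoly.mnm1 k)) = mpoly.mpolyC n ((k == i)%:R).
Proof.
rewrite mpoly.mderivX mpoly.mnm1E; case: (eqVneq k i) => [->|_] /=.
  rewrite scale1r (_ : mpoly.mnm_sub _ _ = @mpoly.mnm0 n) ?mpoly.mpolyX0 ?mpoly.mpolyC1 //.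
  by apply/mpoly.mnmP => l; rewrite mpoly.mnmBE subnn mpoly.mnm0E.
by rewrite scale0r mpoly.mpolyC0.
Qed.

(** The restriction of a polynomial to the line through [x] parallel to the
    axis [i], with parameter 0 at [x]: it turns partial derivatives into
    formal derivatives of a univariate polynomial. *)
Definition axis_line x (i : 'I_n) p : {poly R} :=
  mpoly.mmap (@polyC R) (fun j => (x 0 j)%:P + (i == j)%:R *: 'X) p.

Lemma axis_lineD x i p q : axis_line x i (p + q) = axis_line x i p + axis_line x i q.
Proof. exact: raddfD. Qed.
Lemma axis_lineM x i p q : axis_line x i (p * q) = axis_line x i p * axis_line x i q.
Proof. exact: rmorphM. Qed.
Lemma axis_lineC x i a : axis_line x i (mpoly.mpolyC n a) = a%:P.
Proof. exact: mpoly.mmapC. Qed.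
Lemma axis_lineX x i j :
  axis_line x i (mpoly.mpolyX R (mpoly.mnm1 j)) = (x 0 j)%:P + (i == j)%:R *: 'X.
Proof. by rewrite /axis_line mpoly.mmapX mpoly.mmap1U. Qed.

Lemma axis_line_horner x i p (t : R) :
  (axis_line x i p).[t] = peval p (x + t *: delta_mx 0 i).
Proof.
elim/mpoly_ring_ind: p => [a|j|p q hp hq|p q hp hq].
- by rewrite axis_lineC hornerC pevalC.
- rewrite axis_lineX pevalU !mxE !hornerE /=. by rewrite (eq_sym j) mulrC.
- by rewrite axis_lineD hornerD hp hq pevalD.
- by rewrite axis_lineM hornerM hp hq pevalM.
Qed.

Lemma axis_line_deriv x i p : deriv (axis_line x i p) = axis_line x i (mpoly.mderiv i p).
Proof.
elim/mpoly_ring_ind: p => [a|j|p q hp hq|p q hp hq].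
- by rewrite axis_lineC derivC mpoly.mderivC /axis_line raddf0.
- by rewrite axis_lineX derivD derivC add0r derivZ derivX mderivU axis_lineC eq_sym alg_polyC.
- by rewrite axis_lineD derivD hp hq mpoly.mderivD axis_lineD.
- by rewrite axis_lineM derivM hp hq mpoly.mderivM axis_lineD !axis_lineM.
Qed.

Lemma local_max_crit g x i : (\forall y \near x, peval g y <= peval g x) ->
  peval (mpoly.mderiv i g) x = 0 /\
  peval (mpoly.mderiv i (mpoly.mderiv i g)) x <= 0.
Proof.
move=> /nbhs_ballP[e /= e0 he].
have E p : peval p x = (axis_line x i p).[0] by rewrite axis_line_horner scale0r addr0.
rewrite !E -!axis_line_deriv; apply: (poly_local_max e0) => t te.
rewrite axis_line_horner -E; apply: he; split=> // a b; rewrite !mxE (ord1 a) eqxx /=.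
rewrite /ball /= opprD addNKr normrN normrM; case: (b == i); rewrite ?normr1 ?mulr1 //.
by rewrite normr0 mulr0.
Qed.

End LocalMaximum.


(** * Sums of Huber functions and the polynomials touching them from below *)
Section Touching.
Context {R : realType} {n : nat}.
Implicit Types (p g u w : mpoly.mpoly n R) (x y : 'rV[R]_n).
Implicit Types (us : seq (mpoly.mpoly n R * R)) (d th : R).

(** Equal to [t ^+ 2 / (2 * d) + d / 2] for [`|t| < d] and to [`|t|]
    elsewhere. *)
Definition huber d (t : R) : R :=
  `|t| + Num.max 0 (d - `|t|) ^+ 2 / (2 * d).

Definition grad2 u x : R := \sum_(i < n) peval (mpoly.mderiv i u) x ^+ 2.

Definition euler u x : R := \sum_(i < n) x 0 i * peval (mpoly.mderiv i u) x.

Definition huber_sum us x : R := \sum_(a <- us) huber a.2 (peval a.1 x).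

(** The Laplacian of [huber_sum us] for harmonic members, away from the points
    where one of them switches regime: the linear regime contributes nothing. *)
Definition energy us x : R :=
  \sum_(a <- us) (if `|peval a.1 x| < a.2 then grad2 a.1 x / a.2 else 0).

Definition euler_sum us x : R := \sum_(a <- us) `|euler a.1 x|.

Lemma huber_ge d t : 0 < d -> `|t| <= huber d t.
Proof. by move=> d0; rewrite lerDl divr_ge0 ?exprn_ge0 ?le_max ?lexx ?mulr_ge0 // ltW. Qed.

Lemma huber_ge0 d t : 0 < d -> 0 <= huber d t.
Proof. by move=> d0; apply: le_trans (huber_ge t d0). Qed.

Lemma huber_in d t : 0 < d -> `|t| < d -> huber d t = (2 * d)^-1 * t ^+ 2 + d / 2.
Proof.
move=> d0 td; rewrite /huber max_r; last by rewrite subr_ge0 ltW.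
rewrite -[t ^+ 2]real_normK ?num_real //.
by field; rewrite gt_eqF.
Qed.

Lemma huber_out d t : d <= `|t| -> huber d t = `|t|.
Proof.
by move=> td; rewrite /huber max_l ?subr_le0 // expr0n mul0r addr0.
Qed.

Lemma huber_le d t : 0 < d <= 1 -> huber d t <= `|t| + 1.
Proof.
move=> /andP[d0 d1]; case: (ltP `|t| d) => td.
  rewrite (huber_in d0 td) -[t ^+ 2]real_normK ?num_real //.
  have t0 := normr_ge0 t.
  have : (2 * d)^-1 * `|t| ^+ 2 <= `|t|.
    by rewrite mulrC ler_pdivrMr ?mulr_gt0 // expr2; nra.
  by move=> ?; lra.
by rewrite huber_out // lerDl.
Qed.

Lemma huber_continuous d : continuous (huber d).
Proof.
move=> t; apply: cvgD; first exact: norm_continuous.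
apply: cvgMr_tmp.
apply: (continuous_cvg _ (@exprn_continuous _ _ _)).
apply: (@continuous_cvg _ _ _ (nbhs t) _ (fun t => d - `|t|) (fun s : R => Num.max 0 s)).
  move=> s; rewrite (_ : Num.max 0 = fun r : R => (r + `|r|) / 2); last first.
    by apply/funext => r; rewrite maxr_absE add0r sub0r normrN.
  by apply: cvgMr_tmp; apply: cvgD; [exact: cvg_id|exact: norm_continuous].
by apply: cvgB; [exact: cvg_cst|exact: norm_continuous].
Qed.

Lemma huber_sum_continuous us : continuous (huber_sum us).
Proof.
apply: continuous_big => [|a _ x]; first exact: add_continuous.
apply: (@cvg_comp _ _ _ (peval a.1) (huber a.2)); first exact: peval_continuous.
exact: huber_continuous.
Qed.

Lemma grad2_ge0 u x : 0 <= grad2 u x.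
Proof. by apply: sumr_ge0 => i _; rewrite sqr_ge0. Qed.

Lemma laplacianE p x :
  peval (laplacian p) x = \sum_(i < n) peval (mpoly.mderiv i (mpoly.mderiv i p)) x.
Proof. exact: peval_sumE. Qed.

Lemma laplacianD p u : laplacian (p + u) = laplacian p + laplacian u.
Proof. by rewrite -big_split; apply: eq_bigr => i _; rewrite !mpoly.mderivD. Qed.

Lemma laplacianZ (a : R) p : laplacian (a *: p) = a *: laplacian p.
Proof. by rewrite scaler_sumr; apply: eq_bigr => i _; rewrite !mpoly.mderivZ. Qed.

Lemma laplacianC (a : R) : laplacian (mpoly.mpolyC n a) = 0.
Proof.
by apply: big1 => i _; rewrite mpoly.mderivC -mpoly.mpolyC0 mpoly.mderivC mpoly.mpolyC0.
Qed.

Lemma laplacian_sqr u x : harmonic_poly u -> peval (laplacian (u * u)) x = 2 * grad2 u x.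
Proof.
move=> hu; rewrite laplacianE.
transitivity (2 * grad2 u x + 2 * (peval u x * peval (laplacian u) x)); last first.
  by rewrite hu peval0 !mulr0 addr0.
rewrite laplacianE !mulr_sumr -big_split; apply: eq_bigr => i _ /=.
by rewrite !(mpoly.mderivM, mpoly.mderivD) !pevalD !pevalM; ring.
Qed.

Lemma eulerD p u x : euler (p + u) x = euler p x + euler u x.
Proof.
by rewrite -big_split; apply: eq_bigr => i _; rewrite mpoly.mderivD pevalD mulrDr.
Qed.

Lemma eulerZ (a : R) p x : euler (a *: p) x = a * euler p x.
Proof.
by rewrite mulr_sumr; apply: eq_bigr => i _; rewrite mpoly.mderivZ pevalZ mulrCA.
Qed.

Lemma eulerC (a : R) x : euler (mpoly.mpolyC n a) x = 0.
Proof. by apply: big1 => i _; rewrite mpoly.mderivC peval0 mulr0. Qed.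

Lemma eulerM p u x : euler (p * u) x = euler p x * peval u x + peval p x * euler u x.
Proof.
rewrite mulr_suml mulr_sumr -big_split; apply: eq_bigr => i _ /=.
by rewrite mpoly.mderivM pevalD !pevalM; ring.
Qed.

Definition calibrated us :=
  forall a, a \in us -> harmonic_poly a.1 /\ 0 < a.2 <= 1.

Lemma calibrated_zip (us : seq (mpoly.mpoly n R)) (ds : seq R) :
  size ds = size us -> (forall u, u \in us -> harmonic_poly u) ->
  (forall d, d \in ds -> 0 < d <= 1) -> calibrated (zip us ds).
Proof.
move=> sz hu hd [u d] h; split.
  apply: hu; have -> : us = unzip1 (zip us ds) by rewrite unzip1_zip // sz.
  by apply/mapP; exists (u, d).
apply: hd; have -> : ds = unzip2 (zip us ds) by rewrite unzip2_zip // sz.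
by apply/mapP; exists (u, d).
Qed.

Lemma energy_ge0 us x : calibrated us -> 0 <= energy us x.
Proof.
move=> hus; rewrite /energy big_seq; apply: sumr_ge0 => a /hus[_ /andP[d0 _]].
by case: ifP => // _; rewrite divr_ge0 ?grad2_ge0 // ltW.
Qed.

(** In the linear regime the convex function lies above its tangent, which is
    a multiple of [u] and therefore harmonic; in the quadratic regime it is a
    polynomial near [x]. Replacing [huber] by such a polynomial spares all
    differentiation of a function that is not smooth. *)
Lemma huber_touch u d x : harmonic_poly u -> 0 < d -> exists w,
  [/\ \forall y \near x, peval w y <= huber d (peval u y),
      peval w x = huber d (peval u x),
      peval (laplacian w) x = (if `|peval u x| < d then grad2 u x / d else 0)
    & `|euler w x| <= `|euler u x|].
Proof.
move=> hu d0; case: (ltP `|peval u x| d) => ud.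
  have wE y : peval ((2 * d)^-1 *: (u * u) + mpoly.mpolyC n (d / 2)) y =
      (2 * d)^-1 * peval u y ^+ 2 + d / 2.
    by rewrite pevalD pevalZ pevalM pevalC expr2.
  exists ((2 * d)^-1 *: (u * u) + mpoly.mpolyC n (d / 2)); split.
  - have : \forall y \near x, `|peval u y| < d.
      apply: (@cvgr_lt _ _ (nbhs x) (nbhs_filter x) (fun y => `|peval u y|)
        `|peval u x|) => //.
      by apply: cvg_norm; exact: peval_continuous.
    by apply: filterS => y hy; rewrite wE huber_in.
  - by rewrite wE huber_in.
  - rewrite laplacianD laplacianZ laplacianC addr0 pevalZ laplacian_sqr //.
    by field; rewrite gt_eqF.
  - rewrite eulerD eulerZ eulerC eulerM addr0.
    have -> : (2 * d)^-1 * (euler u x * peval u x + peval u x * euler u x) =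
        (peval u x / d) * euler u x by field; rewrite gt_eqF.
    rewrite normrM ler_piMl // normrM normfV (gtr0_norm d0).
    by rewrite ler_pdivrMr // mul1r ltW.
exists (Num.sg (peval u x) *: u); split.
- near=> y; rewrite pevalZ; apply: le_trans (huber_ge _ d0).
  apply: le_trans (ler_norm _) _; rewrite normrM normr_sg.
  by case: eqP => _; rewrite ?mul0r ?mul1r.
- by rewrite huber_out // pevalZ -normrEsg.
- by rewrite laplacianZ hu pevalZ peval0 mulr0.
- rewrite eulerZ normrM normr_sg.
  by case: eqP => _; rewrite ?mul0r ?mul1r.
Unshelve. all: by end_near.
Qed.

Lemma huber_sum_touch us x : calibrated us -> exists w,
  [/\ \forall y \near x, peval w y <= huber_sum us y,
      peval w x = huber_sum us x,
      peval (laplacian w) x = energy us x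
    & `|euler w x| <= euler_sum us x].
Proof.
elim: us => [|[u d] us ih] hus.
  exists (mpoly.mpolyC n 0); split.
  - by near=> y; rewrite pevalC /huber_sum big_nil.
  - by rewrite pevalC /huber_sum big_nil.
  - by rewrite laplacianC peval0 /energy big_nil.
  - by rewrite eulerC normr0 /euler_sum big_nil.
have [|w [w1 w2 w3 w4]] := ih.
  by move=> a ha; apply: hus; rewrite inE ha orbT.
have [hu /andP[/= d0 _]] := hus _ (mem_head _ _).
have [v [v1 v2 v3 v4]] := huber_touch x hu d0.
exists (v + w); split.
- near=> y; rewrite pevalD /huber_sum big_cons /=.
  by apply: lerD; near: y.
- by rewrite pevalD v2 w2 /huber_sum big_cons.
- by rewrite laplacianD pevalD v3 w3 /energy big_cons.
- rewrite eulerD /euler_sum big_cons /=.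
  by apply: le_trans (ler_normD _ _) _; apply: lerD.
Unshelve. all: by end_near.
Qed.

(** The form in which the maximum principle is used: substituting a touching
    polynomial for [huber_sum us] preserves the local maximum at [x]. *)
Lemma touch_max us g th x : calibrated us -> 0 <= th ->
  (\forall y \near x, peval g y + th * huber_sum us y
                      <= peval g x + th * huber_sum us x) ->
  peval (laplacian g) x + th * energy us x <= 0 /\
  `|euler g x| <= th * euler_sum us x.
Proof.
move=> hus th0 hmax; have [w [w1 w2 w3 w4]] := huber_sum_touch x hus.
have hg : \forall y \near x, peval (g + th *: w) y <= peval (g + th *: w) x.
  near=> y; rewrite !pevalD !pevalZ w2.
  apply: (@le_trans _ _ (peval g y + th * huber_sum us y)); last by near: y.
  by rewrite lerD2l ler_wpM2l //; near: y.
split.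
  rewrite -w3 -pevalZ -laplacianZ -pevalD -laplacianD laplacianE.
  by apply: sumr_le0 => i _; have [] := local_max_crit i hg.
have : euler (g + th *: w) x = 0.
  by apply: big1 => i _; have [-> _] := local_max_crit i hg; rewrite mulr0.
rewrite eulerD eulerZ => /eqP; rewrite addr_eq0 => /eqP ->.
by rewrite normrN normrM (ger0_norm th0) ler_wpM2l.
Unshelve. all: by end_near.
Qed.

End Touching.

(** * Chains of derivatives *)
Section Chain.
Context {R : realType} {n : nat}.
Implicit Types (p u : mpoly.mpoly n R) (x : 'rV[R]_n).

Lemma harmonic_mderiv k p : harmonic_poly p -> harmonic_poly (mpoly.mderiv k p).
Proof.
rewrite /harmonic_poly => hp; rewrite -[RHS](mpoly.mderiv0 R k) -hp /laplacian raddf_sum /=.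
by apply: eq_bigr => i _; rewrite !(mpoly.mderiv_comm k).
Qed.

Lemma msize_mderiv k p D : (mpoly.msize p <= D.+1)%N ->
  (mpoly.msize (mpoly.mderiv k p) <= D)%N.
Proof.
move=> /msize_le_coef hp; apply/msize_le_coef => m hm.
by rewrite mpoly.mcoeff_deriv hp ?mul0rn // mpoly.mdegD mpoly.mdeg1 addn1.
Qed.

Lemma nonconst_mderiv p : (forall c, p <> mpoly.mpolyC n c) ->
  exists k, mpoly.mderiv k p != 0.
Proof.
move=> hp; apply: contrapT => h.
have hk k : mpoly.mderiv k p = 0.
  by apply/eqP; apply: contrapT => hk; apply: h; exists k; apply/negP.
apply: (hp (mpoly.mcoeff (@mpoly.mnm0 n) p)); apply/mpoly.mpolyP => m.
rewrite mpoly.mcoeffC; case: eqP => [->|/eqP hm]; first by rewrite mulr1.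
have [k hmk] : exists k, m k != 0%N.
  apply: contrapT => hm0; case/negP: hm; apply/eqP/mpoly.mnmP => k.
  rewrite mpoly.mnm0E; apply/eqP; apply: contrapT => hmk; apply: hm0.
  by exists k; apply/negP.
rewrite mulr0; have := congr1 (mpoly.mcoeff (mpoly.mnm_sub m (mpoly.mnm1 k))) (hk k).
rewrite mpoly.mcoeff_deriv mpoly.mcoeff0 mpoly.submK; last by rewrite mpoly.lep1mP.
by move/eqP; rewrite mulrn_eq0 /= => /eqP.
Qed.

(** Differentiate [p] repeatedly, each time in a direction in which the
    result is not zero, until a constant is reached. Where [p] is small,
    either its derivative in the chosen direction is bounded below, so that
    the term of [p] itself is as large as desired when its parameter is small,
    or that derivative is small too and the shorter chain applies. The
    parameters are therefore chosen starting from the end of the chain. The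
    chain does not depend on the bound [L], which matters because the growth
    of its members has to be estimated before [L] is fixed. *)
Lemma derivative_chain p : harmonic_poly p -> p != 0 ->
  exists us : seq (mpoly.mpoly n R),
    (forall u, u \in us -> harmonic_poly u /\ (mpoly.msize u <= mpoly.msize p)%N) /\
    forall L : R, exists2 tau, 0 < tau & exists ds : seq R,
      [/\ size ds = size us, (forall d, d \in ds -> 0 < d <= 1)
        & forall x, `|peval p x| <= tau -> L <= energy (zip us ds) x].
Proof.
have [N] := ubnP (mpoly.msize p); elim: N p => // N ih p hN hp p0.
have [[c hc]|hnc] := pselect (exists c, p = mpoly.mpolyC n c).
  exists [::]; split=> // L; exists (`|c| / 2).
    rewrite divr_gt0 // normr_gt0; apply: contraNneq p0 => c0.
    by rewrite hc c0 mpoly.mpolyC0.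
  exists [::]; split=> // x; rewrite hc pevalC => h.
  exfalso; have : 0 < `|c|.
    rewrite normr_gt0; apply: contraNneq p0 => c0.
    by rewrite hc c0 mpoly.mpolyC0.
  by move: h; clear; move=> ? ?; lra.
have [|k hk] := @nonconst_mderiv p; first by move=> c hc; apply: hnc; exists c.
have sp : mpoly.msize p = (mpoly.msize p).-1.+1 by apply: mpoly.mpolySpred.
have sk : (mpoly.msize (mpoly.mderiv k p) <= (mpoly.msize p).-1)%N.
  by apply: msize_mderiv; rewrite -sp.
have [|us [hus hL]] := ih (mpoly.mderiv k p) _ (harmonic_mderiv k hp) hk.
  by rewrite (leq_ltn_trans sk) // -ltnS -sp.
exists (p :: us); split.
  move=> u; rewrite inE => /predU1P[->//|/hus[hu su]]; split=> //.
  by rewrite (leq_trans su) // (leq_trans sk) // leq_pred.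
move=> L; have [tau tau0 [ds [sds hds hE]]] := hL (`|L| + 1).
pose d := Num.min 1 (tau ^+ 2 / (`|L| + 1)).
have L1 : 0 < `|L| + 1 by apply: ltr_wpDl.
have d0 : 0 < d by rewrite lt_min ltr01 divr_gt0 // exprn_gt0.
have d1 : d <= 1 by rewrite ge_min lexx.
have dL : (`|L| + 1) * d <= tau ^+ 2.
  by rewrite mulrC -ler_pdivlMr // ge_min lexx orbT.
have Enn x : 0 <= energy (zip us ds) x.
  by apply: energy_ge0; apply: calibrated_zip => // u /hus[].
exists (d / 2); first by rewrite divr_gt0.
exists (d :: ds); split; first by rewrite /= sds.
  by move=> e; rewrite inE => /predU1P[->|/hds//]; rewrite d0.
move=> x hx; rewrite /= /energy big_cons /= -/(energy _ x).
rewrite ifT; last by move: hx d0; clear; move=> *; lra.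
have L2 : L <= `|L| + 1 by rewrite (le_trans (ler_norm _)) // lerDl.
case: (leP `|peval (mpoly.mderiv k p) x| tau) => hk'.
  apply: (le_trans L2); apply: (le_trans (hE _ hk')).
  by rewrite lerDr divr_ge0 ?grad2_ge0 // ltW.
apply: (le_trans L2); apply: ler_wpDr; first exact: Enn.
rewrite ler_pdivlMr //; apply: (le_trans dL).
rewrite /grad2 (bigD1 k) //= -[leLHS]addr0; apply: lerD; last first.
  by apply: sumr_ge0 => i _; rewrite sqr_ge0.
rewrite -[leRHS]real_normK ?num_real // lerXn2r ?nnegrE //; exact: ltW.
Qed.

End Chain.


(** * Harmonic polynomials change sign at their zeros *)
Section SignChange.
Context {R : realType} {n : nat}.
Implicit Types (p q f u : mpoly.mpoly n R) (x y z v : 'rV[R]_n).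

Lemma coord_le_norm v (i : 'I_n) : `|v 0 i| <= `|v|.
Proof.
have /mapP[j Hj ->] : `|v 0 i| \in [seq `|v x.1 x.2| | x : 'I_1 * 'I_n].
  by apply/mapP; exists (0, i) => //=; rewrite mem_enum.
by rewrite [leRHS]/Num.norm /= mx_normrE; apply/bigmax_geP; right => /=; exists j.
Qed.

Lemma norm_ltP v (e : R) : 0 < e -> (forall i, `|v 0 i| < e) -> `|v| < e.
Proof.
move=> e0 hv; have : ball (0 : 'rV[R]_n) e v.
  by split=> // a b; rewrite (ord1 a) mxE /ball /= sub0r normrN.
by rewrite mx_norm_ball /ball_ /= sub0r normrN.
Qed.

Lemma box_compact z (r : R) : compact [set y | `|y - z| <= r].
Proof.
apply: bounded_closed_compact.
  exists (`|z| + r); split; first exact: num_real.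
  move=> M hM y /= hy; apply: ltW; apply: le_lt_trans hM.
  rewrite -[y in `|y|](subrK z) addrC; apply: le_trans (ler_normD _ _) _.
  by rewrite lerD2l.
apply: (@closed_comp _ _ (fun y => `|y - z|) [set t | t <= r]); last exact: closed_le.
move=> y _; apply: (@cvg_norm _ _ _ (nbhs y)).
by apply: cvgB; [exact: cvg_id|exact: cvg_cst].
Qed.

Definition sqdist z : mpoly.mpoly n R :=
  \sum_(k < n) (mpoly.mpolyX R (mpoly.mnm1 k) - mpoly.mpolyC n (z 0 k)) *
               (mpoly.mpolyX R (mpoly.mnm1 k) - mpoly.mpolyC n (z 0 k)).

Lemma peval_sqdist z x : peval (sqdist z) x = \sum_(k < n) (x 0 k - z 0 k) ^+ 2.
Proof.
rewrite peval_sumE; apply: eq_bigr => k _.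
by rewrite pevalM pevalB pevalU pevalC expr2.
Qed.

Lemma laplacian_sum (I : Type) (s : seq I) (P : pred I) (h : I -> mpoly.mpoly n R) :
  laplacian (\sum_(k <- s | P k) h k) = \sum_(k <- s | P k) laplacian (h k).
Proof.
apply: big_morph; first exact: laplacianD.
by rewrite -mpoly.mpolyC0 laplacianC mpoly.mpolyC0.
Qed.

Lemma laplacian_sqdist z x : peval (laplacian (sqdist z)) x = 2 * n%:R.
Proof.
rewrite laplacian_sum peval_sumE (eq_bigr (fun=> 2)) => [|k _].
  by rewrite sumr_const card_ord mulr_natr.
have D i : mpoly.mderiv i (mpoly.mpolyX R (mpoly.mnm1 k) - mpoly.mpolyC n (z 0 k)) =
    mpoly.mpolyC n ((k == i)%:R).
  by rewrite mpoly.mderivB mderivU mpoly.mderivC subr0.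
rewrite laplacian_sqr; last first.
  by apply: big1 => i _; rewrite D mpoly.mderivC.
rewrite /grad2 (bigD1 k) //= D pevalC eqxx big1 ?addr0 ?expr1n ?mulr1 // => i ik.
by rewrite D pevalC eq_sym (negbTE ik) expr0n.
Qed.

Lemma zip_sum (us : seq (mpoly.mpoly n R)) (ds : seq R) (h : mpoly.mpoly n R -> R) :
  size ds = size us -> \sum_(a <- zip us ds) h a.1 = \sum_(u <- us) h u.
Proof.
move=> sz; rewrite -[us in RHS](@unzip1_zip _ _ us ds) ?sz //.
by rewrite big_map.
Qed.

Lemma huber_sum_ge0 us x : calibrated us -> 0 <= huber_sum us x :> R.
Proof.
move=> hus; rewrite /huber_sum big_seq; apply: sumr_ge0 => a /hus[_ /andP[d0 _]].
exact: huber_ge0.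
Qed.

Lemma huber_sum_le (us : seq (mpoly.mpoly n R)) (ds : seq R) x :
  size ds = size us -> (forall u, u \in us -> harmonic_poly u) ->
  (forall d, d \in ds -> 0 < d <= 1) ->
  huber_sum (zip us ds) x <= \sum_(u <- us) (`|peval u x| + 1).
Proof.
move=> sz hu hd; rewrite -(zip_sum (fun u => `|peval u x| + 1) sz).
rewrite /huber_sum !big_seq; apply: ler_sum => a ha.
by apply: huber_le; have [] := calibrated_zip sz hu hd ha.
Qed.

(** Otherwise [f >= 0] on a box around [z]. There the function
    [K f + |x - z|^2 - th * huber_sum] is at most 0 at [z] and positive on the
    sides of the box, so it has an interior minimum; [K] being large, [f] is
    small at that point. But where [f] is small the energy of the chain exceeds
    the Laplacian [2 n] of [|x - z|^2], against the second-order condition. *)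
Lemma sign_change f z (r : R) : harmonic_poly f -> f != 0 -> peval f z = 0 ->
  0 < r -> exists2 y, `|y - z| <= r & peval f y < 0.
Proof.
move=> hf f0 fz r0; apply: contrapT => hneg.
have fpos y : `|y - z| <= r -> 0 <= peval f y.
  by move=> hy; rewrite leNgt; apply/negP => hlt; apply: hneg; exists y.
have [us [hus chain]] := derivative_chain hf f0.
have hus1 u : u \in us -> harmonic_poly u by move=> /hus[].
pose bd x := \sum_(u <- us) (`|peval u x| + 1).
have bd_cont : continuous bd.
  apply: continuous_big => [|u _ x]; first exact: add_continuous.
  apply: (@cvgD _ _ _ (nbhs x) (nbhs_filter x) (fun y => `|peval u y|) (fun=> 1)).
    by apply: (@cvg_norm _ _ _ (nbhs x) (nbhs_filter x)); exact: peval_continuous.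
  exact: cvg_cst.
have box0 : [set y | `|y - z| <= r] !=set0.
  by exists z; rewrite /= subrr normr0 ltW.
have [c0 _ hc0] := EVT_max_rV box0 (@box_compact z r)
  (continuous_subspaceT bd_cont).
pose B := bd c0.
have hB y : `|y - z| <= r -> bd y <= B by move=> hy; apply: hc0; rewrite inE.
have B0 : 0 <= B by apply: sumr_ge0 => u _; rewrite addr_ge0.
(* th times the sum of Huber functions must stay below the value r ^+ 2 that
   |x - z|^2 reaches on the sides of the box *)
pose th := r ^+ 2 / (B + 1).
have th0 : 0 < th by rewrite divr_gt0 ?exprn_gt0 //; lra.
have thB : th * B < r ^+ 2.
  have r2 : 0 < r ^+ 2 by rewrite exprn_gt0.
  by rewrite /th mulrAC ltr_pdivrMr; [nra | lra].
have [tau tau0 [ds [sz hds hE]]] := chain ((2 * n%:R + 1) / th).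
have cal := calibrated_zip sz hus1 hds.
pose K := (th * B + 1) / tau.
have K0 : 0 < K.
  rewrite divr_gt0 //; have := mulr_ge0 (ltW th0) B0; lra.
pose hs := huber_sum (zip us ds).
pose g := - (K *: f + sqdist z).
pose F x := - (peval g x + th * hs x).
have F_cont : continuous F.
  move=> x; have h : peval g y + th * hs y @[y --> x] --> peval g x + th * hs x.
    apply: (@cvgD _ _ _ (nbhs x) (nbhs_filter x) (peval g) (fun y => th * hs y)).
      exact: peval_continuous.
    by apply: cvgMl_tmp; exact: huber_sum_continuous.
  exact: (cvgN h).
have FE x : F x = K * peval f x + peval (sqdist z) x - th * hs x.
  by rewrite /F /g pevalN pevalD pevalZ opprD opprK.
have [x0 hx0 minF] := EVT_min_rV box0 (@box_compact z r)
  (continuous_subspaceT F_cont).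
have {}hx0 : `|x0 - z| <= r by rewrite inE in hx0.
have Fz : F x0 <= 0.
  apply: (@le_trans _ _ (F z)).
    by apply: minF; rewrite inE /= subrr normr0 ltW.
  rewrite FE fz mulr0 add0r peval_sqdist big1 => [|k _]; last by rewrite subrr expr0n.
  rewrite add0r oppr_le0; apply: mulr_ge0; first exact: ltW.
  exact: huber_sum_ge0.
have hsB : th * hs x0 <= th * B.
  apply: ler_wpM2l; first exact: ltW.
  by apply: (@le_trans _ _ (bd x0)); [exact: huber_sum_le | exact: hB].
have Q0 : 0 <= peval (sqdist z) x0.
  by rewrite peval_sqdist; apply: sumr_ge0 => k _; rewrite sqr_ge0.
have Kf : 0 <= K * peval f x0 by apply: mulr_ge0; [exact: ltW | exact: fpos].
have f_small : `|peval f x0| <= tau.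
  rewrite ger0_norm ?fpos // -(ler_pM2l K0) /K mulfVK ?gt_eqF //.
  by rewrite -/K; rewrite FE in Fz; lra.
have near_box : \forall y \near x0, `|y - z| <= r.
  have : `|x0 - z| < r.
    apply: norm_ltP => // k; rewrite !mxE.
    have : (x0 0 k - z 0 k) ^+ 2 < r ^+ 2.
      apply: (@le_lt_trans _ _ (peval (sqdist z) x0)); last first.
        by rewrite FE in Fz; lra.
      rewrite peval_sqdist (bigD1 k) //= lerDl.
      by apply: sumr_ge0 => i _; rewrite sqr_ge0.
    move=> hk; rewrite -(@ltr_pXn2r _ 2) ?nnegrE ?(ltW r0) //.
    by rewrite real_normK ?num_real.
  move=> hlt; have : \forall y \near x0, `|y - z| < r.
    apply: (@cvgr_lt _ _ (nbhs x0) (nbhs_filter x0) (fun y => `|y - z|)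
      `|x0 - z|) => //.
    by apply: cvg_norm; apply: cvgB; [exact: cvg_id|exact: cvg_cst].
  by apply: filterS => y /ltW.
have : \forall y \near x0, peval g y + th * hs y <= peval g x0 + th * hs x0.
  apply: filterS near_box => y hy; rewrite -lerN2.
  by apply: minF; rewrite inE.
move=> /(touch_max cal (ltW th0)) [+ _].
have -> : peval (laplacian g) x0 = - (2 * n%:R).
  rewrite /g -scaleN1r laplacianZ laplacianD laplacianZ hf scaler0 add0r pevalZ.
  by rewrite laplacian_sqdist mulN1r.
have := hE _ f_small; rewrite ler_pdivrMr // mulrC => h1 h2.
by move: h1 h2; clear; move=> *; lra.
Qed.

End SignChange.


(** * Euler's identity and growth at infinity *)
Section Growth.
Context {R : realType} {n : nat}.
Implicit Types (p q f u : mpoly.mpoly n R) (x y z v : 'rV[R]_n).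

Lemma mulXderiv (i : 'I_n) m :
  mpoly.mpolyX R (mpoly.mnm1 i) * mpoly.mderiv i (mpoly.mpolyX R m) =
  (m i)%:R *: mpoly.mpolyX R m.
Proof.
rewrite mpoly.mderivX -scalerAr -mpoly.mpolyXD.
have [->|mi] := eqVneq (m i) 0%N; first by rewrite !scale0r.
by rewrite mpoly.addmC mpoly.submK // mpoly.lep1mP.
Qed.

Lemma euler_monomial m x :
  euler (mpoly.mpolyX R m) x = (mdeg m)%:R * peval (mpoly.mpolyX R m) x.
Proof.
rewrite mpoly.mdegE natr_sum mulr_suml; apply: eq_bigr => i _.
by rewrite -[RHS]pevalZ -mulXderiv pevalM pevalU.
Qed.

Lemma euler_sumE (I : Type) (s : seq I) (P : pred I) (h : I -> mpoly.mpoly n R) x :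
  euler (\sum_(k <- s | P k) h k) x = \sum_(k <- s | P k) euler (h k) x.
Proof.
apply: (big_morph (fun p => euler p x)); first by move=> p q; exact: eulerD.
by rewrite -mpoly.mpolyC0 eulerC.
Qed.

(** [x.grad] multiplies a monomial by its degree; this gives both Euler's
    identity for homogeneous polynomials and the fact that [x.grad] does not
    raise the degree. *)
Lemma euler_poly_of_coefs p x D : (mpoly.msize p <= D)%N ->
  euler p x = peval (poly_of_coefs D (fun m => (mdeg m)%:R * cf m p)) x.
Proof.
move=> hp; rewrite {1}(mpoly.mpolywE hp) euler_sumE peval_sumE.
by apply: eq_bigr => m _; rewrite eulerZ pevalZ euler_monomial mulrCA mulrA.
Qed.

Definition homog p (j : nat) := forall m, cf m p != 0 -> mdeg m = j.

Lemma euler_homog p j x : homog p j -> euler p x = j%:R * peval p x.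
Proof.
move=> hp; rewrite (euler_poly_of_coefs _ (leqnn (mpoly.msize p))) -pevalZ; congr peval.
apply/mpoly.mpolyP => m; rewrite mcoeff_poly_of_coefs mpoly.mcoeffZ.
have [h0|/hp hj] := eqVneq (cf m p) 0; first by rewrite h0 !mulr0 if_same.
case: ifPn => [_|]; first by rewrite hj.
rewrite -leqNgt => hm; have /msize_le_coef hc := leqnn (mpoly.msize p).
by rewrite (hc _ hm) mulr0.
Qed.

Definition powsum (s : nat) : mpoly.mpoly n R :=
  \sum_(i < n) mpoly.mpolyX R (mpoly.mnm_muln (mpoly.mnm1 i) s).

Lemma peval_powsum s x : peval (powsum s) x = \sum_(i < n) x 0 i ^+ s.
Proof.
rewrite peval_sumE; apply: eq_bigr => i _.
by rewrite -mpoly.mpolyXn /peval rmorphXn /= mpoly.mevalXU.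
Qed.

Lemma euler_powsum s x : euler (powsum s) x = s%:R * peval (powsum s) x.
Proof.
rewrite euler_sumE peval_sumE mulr_sumr; apply: eq_bigr => i _.
by rewrite euler_monomial mpoly.mdegMn mpoly.mdeg1 mul1n.
Qed.

Lemma msize_powsum s : (mpoly.msize (powsum s) <= s.+1)%N.
Proof.
apply/msize_le_coef => m hm; rewrite /powsum raddf_sum /=; apply: big1 => i _.
rewrite mpoly.mcoeffX; case: eqP => // e.
by move: hm; rewrite -e mpoly.mdegMn mpoly.mdeg1 mul1n ltnn.
Qed.

Lemma powsum_ge0 s x : 0 <= peval (powsum s.*2) x.
Proof.
rewrite peval_powsum; apply: sumr_ge0 => i _.
by rewrite -mul2n exprM exprn_ge0 // sqr_ge0.
Qed.

Lemma norm_le_powsum s x : (0 < s)%N -> `|x| ^+ s.*2 <= peval (powsum s.*2) x.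
Proof.
move=> s0.
have [->|x0] := eqVneq `|x| 0; first by rewrite expr0n double_eq0 eqn0Ngt s0 powsum_ge0.
have xp : 0 < `|x| by rewrite lt_neqAle eq_sym x0 normr_ge0.
have [i hi] : exists i, `|x| <= `|x 0 i|.
  apply: contrapT => h; have := @norm_ltP _ _ x _ xp; rewrite ltxx => hh.
  apply: Bool.diff_false_true; apply: hh => i; rewrite ltNge; apply/negP => hi.
  by apply: h; exists i.
rewrite peval_powsum (bigD1 i) //= -[leLHS]addr0; apply: lerD; last first.
  by apply: sumr_ge0 => k _; rewrite -mul2n exprM exprn_ge0 // sqr_ge0.
rewrite -!mul2n !exprM; apply: lerXn2r; rewrite ?nnegrE ?sqr_ge0 //.
rewrite -[leRHS]real_normK ?num_real //.
by apply: lerXn2r; rewrite ?nnegrE.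
Qed.

Definition subdominant (s : nat) (h : 'rV[R]_n -> R) :=
  forall e : R, 0 < e -> exists C : R, forall x, h x <= e * peval (powsum s.*2) x + C.

Lemma subdominantD s h1 h2 : subdominant s h1 -> subdominant s h2 ->
  subdominant s (fun x => h1 x + h2 x).
Proof.
move=> n1 n2 e e0; have [C1 hC1] := n1 (e / 2) ltac:(lra).
have [C2 hC2] := n2 (e / 2) ltac:(lra).
exists (C1 + C2) => x; have := hC1 x; have := hC2 x.
by move: (peval _ x) => t; lra.
Qed.

Lemma subdominant_cst s c : subdominant s (fun=> c).
Proof.
move=> e e0; exists c => x; rewrite lerDr mulr_ge0 ?powsum_ge0 //; exact: ltW.
Qed.

Lemma subdominantZ s c h : 0 <= c -> subdominant s h -> subdominant s (fun x => c * h x).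
Proof.
move=> c0 hn e e0; have [C hC] := hn (e / (c + 1)) ltac:(by rewrite divr_gt0 //; lra).
exists (c * C) => x; apply: (le_trans (ler_wpM2l c0 (hC x))).
rewrite mulrDr lerD2r mulrA ler_wpM2r ?powsum_ge0 //.
by rewrite mulrA ler_pdivrMr; nra.
Qed.

Lemma subdominant_sum s (I : eqType) (r : seq I) (h : I -> 'rV[R]_n -> R) :
  (forall i, i \in r -> subdominant s (h i)) ->
  subdominant s (fun x => \sum_(i <- r) h i x).
Proof.
elim: r => [|a r ih] hr.
  under eq_fun do rewrite big_nil; exact: subdominant_cst.
under eq_fun do rewrite big_cons; apply: subdominantD.
  by apply: hr; rewrite mem_head.
by apply: ih => i hi; apply: hr; rewrite inE hi orbT.
Qed.

Lemma subdominant_le s h1 h2 : (forall x, h1 x <= h2 x) ->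
  subdominant s h2 -> subdominant s h1.
Proof.
move=> hle hn e e0; have [C hC] := hn e e0.
by exists C => x; apply: le_trans (hC x).
Qed.

(** Only [msize p <= s.*2], that is degree less than [s.*2], makes an
    arbitrarily small multiple sufficient. *)
Lemma subdominant_poly s p : (0 < s)%N -> (mpoly.msize p <= s.*2)%N ->
  subdominant s (fun x => `|peval p x|).
Proof.
move=> s0 hp.
apply: (@subdominant_le _ _ (fun x => \sum_(m : mpoly.bmultinom n s.*2)
    `|cf m p| * `|x| ^+ mdeg m)).
  move=> x; rewrite (peval_sum x hp); apply: le_trans (ler_norm_sum _ _ _) _.
  apply: ler_sum => m _; rewrite normrM ler_wpM2l // normr_prod.
  rewrite mpoly.mdegE -prodrXr; apply: ler_prod => i _.
  by rewrite normrX exprn_ge0 //= lerXn2r ?nnegrE // coord_le_norm.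
apply: subdominant_sum => m _; apply: subdominantZ => //.
move=> e e0; pose T : R := 1 + e^-1.
have T1 : 1 <= T by rewrite lerDl invr_ge0 ltW.
exists (T ^+ mdeg m) => x; have [xT|Tx] := lerP `|x| T.
  apply: (@le_trans _ _ (T ^+ mdeg m)).
    by rewrite lerXn2r ?nnegrE // (le_trans _ T1).
  by rewrite lerDr mulr_ge0 ?powsum_ge0 // ltW.
have x1 : 1 <= `|x| by rewrite (le_trans T1) // ltW.
rewrite -[leLHS]addr0; apply: lerD; last by rewrite exprn_ge0 // (le_trans _ T1).
have : e * `|x| ^+ s.*2 <= e * peval (powsum s.*2) x.
  by rewrite ler_pM2l // norm_le_powsum.
apply: le_trans; apply: (@le_trans _ _ (e * `|x| ^+ (mdeg m).+1)); last first.
  by rewrite ler_pM2l // ler_weXn2l // mpoly.bmdeg.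
rewrite exprS mulrA ler_peMl ?exprn_ge0 //.
rewrite -ler_pdivrMl // mulr1; apply: le_trans (ltW Tx).
by rewrite lerDr.
Qed.

End Growth.


(** * Homogeneous harmonic polynomials of different degrees *)
Section Comparison.
Context {R : realType} {n : nat}.
Implicit Types (p q f u : mpoly.mpoly n R) (x y z v : 'rV[R]_n).

(** Let [C] be the closed set where [p >= 0] and [q >= 0], and let [M] be the
    maximum over [C] of [q / F], with
    [F = K * |p| + 2 * W + A - huber_sum]. It is attained since [q] is
    negligible before [W] at infinity, and at an interior point [x0] of [C]
    since [q x0 > 0] forces [p x0 <> 0]. There [q - M * F] has a local maximum.
    Combining the two conclusions of [touch_max] with Euler's identities
    bounds [K * (j - m) * p x0] plus the energy by a constant known before
    [K] and the parameters are chosen. This is false where [p] is small,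
    because of the energy, and elsewhere because of [K]. *)
Lemma homog_zeros_not_included p q (j m : nat) x1 :
  harmonic_poly p -> harmonic_poly q -> homog p j -> homog q m -> (m < j)%N ->
  (forall x, peval p x = 0 -> peval q x = 0) ->
  0 < peval p x1 -> 0 < peval q x1 -> False.
Proof.
move=> hp hq homp homq mj zpq px1 qx1.
have p0 : p != 0 by apply: contraTneq px1 => ->; rewrite peval0 ltxx.
have [us [hus chain]] := derivative_chain hp p0.
have hus1 u : u \in us -> harmonic_poly u by move=> /hus[].
pose s := (mpoly.msize p + mpoly.msize q + m).+1.
have s0 : (0 < s)%N by [].
pose Wp : mpoly.mpoly n R := powsum s.*2.
pose W x := peval Wp x.
have W0 x : 0 <= W x := powsum_ge0 s x.
have small f : (mpoly.msize f <= mpoly.msize p)%N \/ (mpoly.msize f <= mpoly.msize q)%N ->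
    (mpoly.msize f <= s.*2)%N.
  by rewrite /s -addnn; case=> h; lia.
(* with this constant the comparison function F is at least 1 + W *)
have [A hA] : exists A : R, 0 <= A /\
    forall x, 1 + \sum_(u <- us) (`|peval u x| + 1) <= W x + A.
  have : subdominant s (fun x => 1 + \sum_(u <- us) (`|peval u x| + 1)).
    apply: subdominantD; first exact: subdominant_cst.
    apply: subdominant_sum => u /hus[_ su]; apply: subdominantD.
      by apply: subdominant_poly => //; apply: small; left.
    exact: subdominant_cst.
  move=> /(_ 1 ltr01)[C hC]; exists `|C|; split=> // x.
  by apply: (le_trans (hC x)); rewrite mul1r lerD2l ler_norm.
case: hA => A0 hA.
(* what the energy and the term in K have to beat *)
have [C hC] : exists C : R, forall x, 2 * peval (laplacian Wp) x +
    \sum_(u <- us) `|euler u x| + m%:R * A <= W x + C.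
  have : subdominant s (fun x => 2 * peval (laplacian Wp) x +
      \sum_(u <- us) `|euler u x| + m%:R * A).
    apply: subdominantD; last exact: subdominant_cst.
    apply: subdominantD.
      apply: subdominantZ => //.
      apply: (@subdominant_le _ _ _ _ (fun x => `|peval (laplacian Wp) x|)).
        by move=> x; exact: ler_norm.
      apply: subdominant_poly => //; apply/msize_le_coef => k hk.
      rewrite /laplacian raddf_sum /=; apply: big1 => i _.
      have /msize_le_coef hW := msize_powsum (R := R) (n := n) s.*2.
      rewrite !mpoly.mcoeff_deriv /Wp hW ?mul0rn //.
      by rewrite !mpoly.mdegD !mpoly.mdeg1; lia.
    apply: subdominant_sum => u /hus[_ su].
    apply: (@subdominant_le _ _ _ _ (fun x =>
       `|peval (poly_of_coefs (mpoly.msize u) (fun k => (mdeg k)%:R * cf k u)) x|)).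
      by move=> x; rewrite -euler_poly_of_coefs.
    apply: subdominant_poly => //; apply: leq_trans (msize_poly_of_coefs _ _) _.
    by apply: small; left.
  move=> /(_ 1 ltr01)[C hC]; exists C => x.
  by have := hC x; rewrite mul1r.
have [tau tau0 [ds [sz hds hE]]] := chain (`|C| + 1).
have cal := calibrated_zip sz hus1 hds.
pose hs := huber_sum (zip us ds).
pose K := (`|C| + 1) / tau.
have K0 : 0 < K by rewrite divr_gt0 // ltr_wpDl.
pose F x := K * `|peval p x| + 2 * W x + A - hs x.
have hsle x : 1 + hs x <= W x + A.
  by apply: le_trans (hA x); rewrite lerD2l; exact: huber_sum_le.
have hs0 x : 0 <= hs x by exact: huber_sum_ge0.
have FW x : 1 + W x <= F x.
  have : 0 <= K * `|peval p x| by rewrite mulr_ge0 // ltW.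
  by have := hsle x; rewrite /F; lra.
have F1 x : 0 < F x by apply: lt_le_trans (FW x); have := W0 x; lra.
have W_cont : continuous W := @peval_continuous _ _ Wp.
have F_cont : continuous F.
  move=> x; apply: (@cvgB _ _ _ (nbhs x) (nbhs_filter x)
    (fun y => K * `|peval p y| + 2 * W y + A) hs); last exact: huber_sum_continuous.
  apply: (@cvgD _ _ _ (nbhs x) (nbhs_filter x)
    (fun y => K * `|peval p y| + 2 * W y) (fun=> A)); last exact: cvg_cst.
  apply: (@cvgD _ _ _ (nbhs x) (nbhs_filter x)
    (fun y => K * `|peval p y|) (fun y => 2 * W y)).
    apply: cvgMl_tmp; apply: (@cvg_norm _ _ _ (nbhs x) (nbhs_filter x)).
    exact: peval_continuous.
  by apply: cvgMl_tmp; exact: W_cont.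
pose rho x := peval q x / F x.
have rho_cont : continuous rho.
  move=> x; apply: (@cvgM _ _ (nbhs x) (nbhs_filter x) (peval q) (fun y => (F y)^-1)).
    exact: peval_continuous.
  apply: (@cvgV _ _ (nbhs x) (nbhs_filter x) F); last exact: F_cont.
  by rewrite gt_eqF.
have rho1 : 0 < rho x1 by rewrite divr_gt0.
have [B hB] := @subdominant_poly R n s q s0 (small q (or_intror (leqnn _))) (rho x1 / 2)
  ltac:(lra).
(* beyond this level the quotient is below its value at x1 *)
pose W1 := W x1 + 2 * `|B| / rho x1.
have hW1 x : W1 < W x -> peval q x <= rho x1 * F x.
  move=> hx; have h1 := le_trans (ler_norm _) (hB x).
  have h2 : rho x1 * (1 + W x) <= rho x1 * F x by rewrite ler_pM2l.
  have h3 : 2 * `|B| < W x * rho x1.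
    rewrite -ltr_pdivrMr //; apply: le_lt_trans hx.
    by rewrite /W1 lerDr.
  have h4 := ler_norm B.
  by move: h1 h2 h3 h4 rho1; rewrite -/Wp -/(W x); clear; move=> *; lra.
pose Cs := [set x | [/\ 0 <= peval p x, 0 <= peval q x & W x <= W1]].
have clo f : closed [set x | 0 <= peval f x].
  apply: (@closed_comp _ _ (peval f) [set t | 0 <= t]); last exact: closed_ge.
  by move=> y _; exact: peval_continuous.
have Cs_compact : compact Cs.
  apply: bounded_closed_compact.
    exists (1 + `|W1|); split; first exact: num_real.
    move=> M hM y [_ _ hy]; apply: ltW; apply: le_lt_trans hM.
    rewrite leNgt; apply/negP => hlt.
    have y1 : 1 <= `|y|.
      by apply: ltW; apply: (@le_lt_trans _ _ (1 + `|W1|)); rewrite // lerDl.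
    have := le_trans (norm_le_powsum y s0) hy; rewrite leNgt => /negP; apply.
    apply: (@lt_le_trans _ _ `|y|).
      apply: (@le_lt_trans _ _ (1 + `|W1|)) => //.
      by rewrite (le_trans (ler_norm _)) // lerDr.
    by rewrite -[leLHS]expr1; apply: ler_weXn2l => //; rewrite -addnn; lia.
  rewrite (_ : Cs = [set x | 0 <= peval p x] `&`
    ([set x | 0 <= peval q x] `&` [set x | W x <= W1])); last first.
    by apply/seteqP; split=> x /= => [[a b c]|[a [b c]]].
  apply: closedI; first exact: clo.
  apply: closedI; first exact: clo.
  apply: (@closed_comp _ _ W [set t | t <= W1]); last exact: closed_le.
  by move=> y _; exact: W_cont.
have Cs_x1 : Cs x1.
  split; [exact: ltW | exact: ltW | ].
  rewrite /W1 lerDl; apply: divr_ge0; last exact: ltW.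
  exact: mulr_ge0.
have [x0 hx0 maxr] := EVT_max_rV (ex_intro _ x1 Cs_x1) Cs_compact
  (continuous_subspaceT rho_cont).
have {}hx0 : Cs x0 by rewrite inE in hx0.
pose M := rho x0.
have M1 : rho x1 <= M by apply: maxr; rewrite inE.
have M0 : 0 < M by apply: lt_le_trans M1.
have qF x : 0 <= peval p x -> 0 <= peval q x -> peval q x <= M * F x.
  move=> px qx; have [hx|/hW1 hx] := lerP (W x) W1.
    rewrite -ler_pdivrMr //; apply: maxr; rewrite inE; split=> //.
  by apply: (le_trans hx); rewrite ler_pM2r.
have qx0 : peval q x0 = M * F x0 by rewrite /M /rho mulfVK // gt_eqF.
have qpos : 0 < peval q x0 by rewrite qx0 mulr_gt0.
have ppos : 0 < peval p x0.
  case: hx0 => px _ _; rewrite lt_neqAle px andbT eq_sym.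
  by apply: contraTneq qpos => /zpq ->; rewrite ltxx.
pose g := q - M *: (K *: p + 2 *: Wp + mpoly.mpolyC n A).
have gE x : 0 <= peval p x -> peval g x + M * hs x = peval q x - M * F x.
  move=> px; rewrite /g /F pevalB !pevalZ !pevalD !pevalZ pevalC (ger0_norm px) -/(W x).
  by ring.
have : \forall y \near x0, peval g y + M * hs y <= peval g x0 + M * hs x0.
  rewrite (gE x0) ?ltW // qx0 subrr.
  have np : \forall y \near x0, 0 < peval p y.
    apply: (@cvgr_gt _ _ (nbhs x0) (nbhs_filter x0) (peval p) (peval p x0)) => //.
    exact: peval_continuous.
  have nq : \forall y \near x0, 0 < peval q y.
    apply: (@cvgr_gt _ _ (nbhs x0) (nbhs_filter x0) (peval q) (peval q x0)) => //.
    exact: peval_continuous.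
  near=> y; have py : 0 < peval p y by near: y.
  have qy : 0 < peval q y by near: y.
  by rewrite gE ?subr_le0 ?qF // ltW.
move=> /(touch_max cal (ltW M0)) [lap eul].
have {}lap : energy (zip us ds) x0 <= 2 * peval (laplacian Wp) x0.
  move: lap; have -> : peval (laplacian g) x0 = - (M * (2 * peval (laplacian Wp) x0)).
    rewrite /g -scaleN1r !laplacianD !laplacianZ hq !laplacianD !laplacianZ hp laplacianC.
    by rewrite scaler0 addr0 !add0r !pevalZ mulN1r.
  by rewrite addrC subr_le0 ler_pM2l.
have {}eul : K * ((j%:R - m%:R) * peval p x0) <=
    \sum_(u <- us) `|euler u x0| + m%:R * A - 2 * W x0.
  have eg : euler g x0 = m%:R * peval q x0 -
      M * (K * (j%:R * peval p x0) + 2 * (s.*2%:R * W x0)).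
    rewrite /g -scaleN1r !eulerD !eulerZ !eulerD !eulerZ eulerC.
    by rewrite (euler_homog _ homp) (euler_homog _ homq) euler_powsum; ring.
  have hxs : euler_sum (zip us ds) x0 = \sum_(u <- us) `|euler u x0|.
    by rewrite /euler_sum (zip_sum (fun u => `|euler u x0|) sz).
  move: eul; rewrite hxs ler_norml => /andP[+ _].
  rewrite eg qx0 -mulrN mulrCA -mulrBr ler_pM2l // /F (gtr0_norm ppos).
  have s2 : (m.+1)%:R <= s.*2%:R :> R by rewrite ler_nat /s -addnn; lia.
  have h1 : (m.+1)%:R * W x0 <= s.*2%:R * W x0 by rewrite ler_wpM2r.
  have h2 : 0 <= m%:R * hs x0 by rewrite mulr_ge0.
  move: h1 h2; rewrite -natr1.
  move: (\sum_(u <- us) _) (hs x0) (W x0) (s.*2%:R : R) (m%:R : R) => t1 t2 t3 t4 t5.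
  by clear; move=> *; nra.
have jm : (1 : R) <= j%:R - m%:R by rewrite -natrB ?(ltnW mj) // ler1n subn_gt0.
have Kp : K * peval p x0 <= K * ((j%:R - m%:R) * peval p x0).
  by rewrite ler_pM2l // ler_peMl // ltW.
have tot : K * peval p x0 + energy (zip us ds) x0 <= `|C|.
  have := hC x0; have := W0 x0; have := ler_norm C.
  by move: eul lap Kp; clear; move=> *; lra.
have [psmall|plarge] := lerP `|peval p x0| tau.
  have := hE _ psmall; have : 0 <= K * peval p x0 by rewrite mulr_ge0 // ltW.
  by move: tot; clear; move=> *; lra.
have e0 := energy_ge0 x0 cal.
have : `|C| + 1 <= K * peval p x0.
  rewrite (gtr0_norm ppos) in plarge.
  by rewrite /K mulrAC ler_pdivlMr // ler_wpM2l ?addr_ge0 // ltW.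
by move: tot e0; clear; move=> *; lra.
Unshelve. all: by end_near.
Qed.

End Comparison.


(** * The Euclidean norm and the sup norm *)
Section Norms.
Context {R : realType} {n : nat}.
Implicit Types (p q : mpoly.mpoly n R) (x y z v : 'rV[R]_n).

Lemma l2norm_ge0 v : 0 <= l2norm v.
Proof. exact: sqrtr_ge0. Qed.

Lemma l2norm0 : l2norm (0 : 'rV[R]_n) = 0.
Proof. by rewrite /l2norm big1 ?sqrtr0 // => i _; rewrite mxE expr0n. Qed.

Lemma l2normZ (a : R) v : l2norm (a *: v) = `|a| * l2norm v.
Proof.
rewrite -sqrtr_sqr -sqrtrM ?sqr_ge0 //; congr Num.sqrt.
by rewrite mulr_sumr; apply: eq_bigr => i _; rewrite mxE exprMn.
Qed.

Lemma l2norm_le v : l2norm v <= n%:R * `|v|.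
Proof.
have nv : 0 <= n%:R * `|v| by rewrite mulr_ge0.
rewrite -(ger0_norm nv) -sqrtr_sqr ler_wsqrtr //.
case: n v nv => [|k] v nv; first by rewrite big_ord0 sqr_ge0.
apply: (@le_trans _ _ (\sum_(i < k.+1) `|v| ^+ 2)).
  apply: ler_sum => i _; rewrite -[leLHS]real_normK ?num_real //.
  by apply: lerXn2r; rewrite ?nnegrE // coord_le_norm.
rewrite sumr_const card_ord -[leLHS]mulr_natl exprMn ler_wpM2r ?sqr_ge0 //.
by rewrite -natrX ler_nat -{1}[k.+1]expn1 leq_pexp2l.
Qed.

Lemma norm_le_l2norm v : `|v| <= l2norm v.
Proof.
rewrite leNgt; apply/negP => h.
have v0 : 0 < `|v| by apply: le_lt_trans h; exact: l2norm_ge0.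
suff : `|v| < `|v| by rewrite ltxx.
apply: norm_ltP => // i; apply: le_lt_trans h.
rewrite -sqrtr_sqr ler_wsqrtr // (bigD1 i) //= lerDl.
by apply: sumr_ge0 => k _; rewrite sqr_ge0.
Qed.

Lemma l2norm_continuous : continuous (@l2norm R n).
Proof.
move=> v; apply: (@cvg_comp _ _ _ (fun w : 'rV[R]_n => \sum_(i < n) w 0 i ^+ 2) Num.sqrt);
  last exact: sqrt_continuous.
have : continuous (fun w : 'rV[R]_n => \sum_(i < n) w 0 i ^+ 2); last exact.
apply: continuous_big => [|i _ w]; first exact: add_continuous.
apply: (@cvg_comp _ _ _ (fun w : 'rV[R]_n => w 0 i) (fun t => t ^+ 2)).
  exact: coord_continuous.
exact: exprn_continuous.
Qed.

End Norms.

(** * Limits of polynomials and of their zero sets *)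
Section Limits.
Context {R : realType} {n : nat}.
Implicit Types (p q : mpoly.mpoly n R) (x y z v : 'rV[R]_n).

Definition coef_cvg (I : Type) (F : set_system I) (ps : I -> mpoly.mpoly n R) p :=
  forall m, cf m (ps i) @[i --> F] --> cf m p.

(** Along an ultrafilter every family with values in a compact set converges,
    which replaces the extraction of subsequences. *)
Lemma ultra_cvg (I : Type) (U : set_system I) {UU : UltraFilter U}
    (T : topologicalType) (A : set T) (f : I -> T) :
  compact A -> (forall i, A (f i)) -> exists2 l, A l & f @ U --> l.
Proof.
move=> cA fA; have FA : \forall i \near U, A (f i) by exact: nearW.
have [l [Al cl]] := cA (f @ U) _ FA.
exists l => // V nV; have [//|h] := in_ultra_setVsetC (f @^-1` V) UU.
have [y [h1 h2]] := cl (~` V) V h nV.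
by case: (h1 h2).
Qed.

Lemma harmonic_lim (I : Type) (F : set_system I) {FF : ProperFilter F} ps p :
  coef_cvg F ps p -> (forall i, harmonic_poly (ps i)) -> harmonic_poly p.
Proof.
move=> hc hp; apply/harmonicP => m.
pose h q := \sum_(i < n) cf (addm (addm m (U_ i)) (U_ i)) q *+ (m i).+2 *+ (m i).+1.
have c1 : h (ps i) @[i --> F] --> h p.
  apply: cvg_big => [|i _]; first exact: add_continuous.
  by apply: cvgMn; apply: cvgMn; exact: hc.
have h0 i : h (ps i) = 0 by have /harmonicP := hp i; exact.
have c2 : h (ps i) @[i --> F] --> (0 : R).
  by under eq_fun do rewrite h0; exact: cvg_cst.
exact: (cvg_unique _ c1 c2).
Qed.

(** With [D] at most the degree this is the size of the low part only. *)
Definition norm1 (D : nat) p : R := \sum_(m : mpoly.bmultinom n D) `|cf m p|.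

Lemma norm1_ge0 D p : 0 <= norm1 D p.
Proof. exact: sumr_ge0. Qed.

Lemma coef_le_norm1 D p (m : mon n) : (mdeg m < D)%N -> `|cf m p| <= norm1 D p.
Proof.
move=> hm; rewrite /norm1 (bigD1 (mpoly.BMultinom hm)) //= lerDl.
exact: sumr_ge0.
Qed.

Lemma norm1_eq0 D p : norm1 D p = 0 -> forall m, (mdeg m < D)%N -> cf m p = 0.
Proof.
by move=> h m /(coef_le_norm1 p); rewrite h normr_le0 => /eqP.
Qed.

Lemma norm1_gt0 D p : (mpoly.msize p <= D)%N -> p != 0 -> 0 < norm1 D p.
Proof.
move=> /msize_le_coef sp p0; rewrite lt_neqAle norm1_ge0 andbT eq_sym.
apply: contraNneq p0 => h; apply/eqP/mpoly.mpolyP => m; rewrite mpoly.mcoeff0.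
by case: (ltnP (mdeg m) D) => hm; [exact: (norm1_eq0 h) | exact: sp].
Qed.

Lemma norm1Z D (a : R) p : norm1 D (a *: p) = `|a| * norm1 D p.
Proof.
by rewrite mulr_sumr; apply: eq_bigr => m _; rewrite mpoly.mcoeffZ normrM.
Qed.

Lemma norm1_cvg (I : Type) (F : set_system I) {FF : Filter F} D ps p :
  coef_cvg F ps p -> norm1 D (ps i) @[i --> F] --> norm1 D p.
Proof.
move=> hc; apply: cvg_big => [|m _]; first exact: add_continuous.
by apply: cvg_norm; exact: hc.
Qed.

Lemma poly_ultra_lim (I : Type) (U : set_system I) {UU : UltraFilter U} D
    (ps : I -> mpoly.mpoly n R) :
  (forall i, (mpoly.msize (ps i) <= D)%N) -> (forall i, norm1 D (ps i) = 1) ->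
  exists p, [/\ (mpoly.msize p <= D)%N, coef_cvg U ps p & p != 0].
Proof.
move=> sps nps.
have lims (m : mon n) : exists l : R, cf m (ps i) @[i --> U] --> l.
  have [i|l _ hl] := @ultra_cvg _ U UU R `[-1, 1]%classic
    (fun i => cf m (ps i)) (@segment_compact _ _ _).
    rewrite /= in_itv /= -ler_norml.
    case: (ltnP (mdeg m) D) => hm; first by rewrite -(nps i) coef_le_norm1.
    by have /msize_le_coef -> := sps i; rewrite ?normr0.
  by exists l.
have [l hl] := choice lims.
have cvgp : coef_cvg U ps (poly_of_coefs D l).
  move=> m; rewrite mcoeff_poly_of_coefs; case: ifPn => hm; first exact: hl.
  have h i : cf m (ps i) = 0.
    by have /msize_le_coef -> := sps i; rewrite // leqNgt.
  by under eq_fun do rewrite h; exact: cvg_cst.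
exists (poly_of_coefs D l); split=> //; first exact: msize_poly_of_coefs.
have n1 : norm1 D (ps i) @[i --> U] --> norm1 D (poly_of_coefs D l) by exact: norm1_cvg.
have n2 : norm1 D (ps i) @[i --> U] --> (1 : R).
  by under eq_fun do rewrite nps; exact: cvg_cst.
have n3 : norm1 D (poly_of_coefs D l) = 1 by exact: (cvg_unique _ n1 n2).
apply/eqP => h0; have := oner_neq0 R; rewrite -n3 h0 /norm1 big1 ?eqxx // => m _.
by rewrite mpoly.mcoeff0 normr0.
Qed.

(** Nonvanishing is uniform on a neighbourhood of [z], since evaluation is
    continuous jointly in the polynomial and the point. *)
Lemma coef_cvg_nonzero (I : Type) (F : set_system I) {FF : Filter F} D ps p z :
  (forall i, (mpoly.msize (ps i) <= D)%N) -> (mpoly.msize p <= D)%N ->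
  coef_cvg F ps p -> peval p z != 0 ->
  exists2 r : R, 0 < r &
    \forall i \near F, forall y, `|y - z| < r -> peval (ps i) y != 0.
Proof.
move=> sps sp hc pz.
have hF : Filter (filter_prod F (nbhs z)) by apply: filter_prod_filter.
have hcvg : peval (ps a.1) a.2 @[a --> filter_prod F (nbhs z)] --> peval p z.
  apply: (@cvg_peval _ _ _ _ hF D (fun a => ps a.1) p (fun a => a.2) z) => //.
    move=> m; apply: (@cvg_comp _ _ _ fst (fun i => cf m (ps i)) _ F); last exact: hc.
    exact: cvg_fst.
  exact: cvg_snd.
have [[A B] /= [FA FB] hAB] := cvgr_neq0 _ hcvg pz.
have /nbhs_ballP[r /= r0 hr] := FB.
exists r => //; apply: filterS FA => i Ai y hy.
apply: (hAB (i, y)); split=> //=; apply: hr.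
by rewrite mx_norm_ball /ball_ /= distrC.
Qed.

Lemma zero_between p x y : peval p x < 0 -> 0 < peval p y ->
  exists2 t : R, 0 <= t <= 1 & peval p (x + t *: (y - x)) = 0.
Proof.
move=> px py; pose f t := peval p (x + t *: (y - x)).
have f0 : f 0 = peval p x by rewrite /f scale0r addr0.
have f1 : f 1 = peval p y by rewrite /f scale1r addrC subrK.
have fc : continuous f.
  move=> t; apply: (@cvg_comp _ _ _ (fun t => x + t *: (y - x)) (peval p));
    last exact: peval_continuous.
  apply: (@cvgD _ _ _ (nbhs t) (nbhs_filter t) (fun=> x) (fun s : R => s *: (y - x))).
    exact: cvg_cst.
  by apply: cvgZr_tmp; exact: cvg_id.
have f01 : Num.min (f 0) (f 1) <= 0 <= Num.max (f 0) (f 1).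
  by rewrite f0 f1 ge_min le_max (ltW px) (ltW py) orbT.
have [t ht ft] := IVT ler01 (continuous_subspaceT fc) f01.
by exists t => //; rewrite in_itv in ht.
Qed.

(** The limit takes both signs near [z], hence so do its approximations, and
    the intermediate value theorem on a segment gives them a zero. *)
Lemma approx_zero (I : Type) (F : set_system I) {FF : Filter F} D qs q z (r : R) :
  (forall i, (mpoly.msize (qs i) <= D)%N) -> (mpoly.msize q <= D)%N ->
  coef_cvg F qs q -> harmonic_poly q -> q != 0 -> peval q z = 0 -> 0 < r ->
  \forall i \near F, exists2 y, `|y - z| <= r & peval (qs i) y = 0.
Proof.
move=> sqs sq hc hq q0 qz r0.
have [y1 hy1 qy1] := sign_change hq q0 qz r0.
have [|||y2 hy2 qy2] := @sign_change _ _ (- q) z r _ _ _ r0.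
- by rewrite /harmonic_poly -scaleN1r laplacianZ hq scaler0.
- by rewrite oppr_eq0.
- by rewrite pevalN qz oppr0.
have pt y : peval (qs i) y @[i --> F] --> peval q y.
  by apply: (cvg_peval sqs sq hc); exact: cvg_cst.
rewrite pevalN oppr_lt0 in qy2.
near=> i.
have h1 : peval (qs i) y1 < 0 by near: i; exact: (cvgr_lt _ (pt y1)).
have h2 : 0 < peval (qs i) y2 by near: i; exact: (cvgr_gt _ (pt y2)).
have [t /andP[t0 t1] ht] := zero_between h1 h2.
exists (y1 + t *: (y2 - y1)) => //.
have -> : y1 + t *: (y2 - y1) - z = (1 - t) *: (y1 - z) + t *: (y2 - z).
  by apply/rowP => k; rewrite !mxE; ring.
apply: (le_trans (ler_normD _ _)); rewrite !normrZ.
rewrite (ger0_norm t0) ger0_norm ?subr_ge0 //.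
have -> : r = (1 - t) * r + t * r by ring.
by apply: lerD; rewrite ler_wpM2l ?subr_ge0.
Unshelve. all: by end_near.
Qed.

(** The quantitative inclusion of zero sets that bounds one of the two suprema
    in [Theta]. *)
Definition zeros_near p q (rad e : R) := forall a, peval p a = 0 -> l2norm a < rad ->
  exists2 b, peval q b = 0 & l2norm (a - b) < e.

(** A zero of the limit [q] is approached by zeros of the [qs i], hence by
    zeros of the [ps i], whose limits are zeros of [p]. *)
Lemma zeros_near_lim (I : Type) (F : set_system I) {FF : ProperFilter F} D ps qs p q
    (rad : R) z :
  (forall i, (mpoly.msize (ps i) <= D)%N) -> (mpoly.msize p <= D)%N ->
  (forall i, (mpoly.msize (qs i) <= D)%N) -> (mpoly.msize q <= D)%N ->
  coef_cvg F ps p -> coef_cvg F qs q -> harmonic_poly q -> q != 0 ->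
  (forall e, 0 < e -> \forall i \near F, zeros_near (qs i) (ps i) rad e) ->
  l2norm z < rad -> peval q z = 0 -> peval p z = 0.
Proof.
move=> sps sp sqs sq cp cq hq q0 hnear zrad qz.
apply/eqP; apply: contrapT => /negP pz.
have [r r0 hr] := coef_cvg_nonzero sps sp cp pz.
have /nbhs_ballP[r1 /= r10 hr1] : \forall y \near z, l2norm y < rad.
  apply: (@cvgr_lt _ _ (nbhs z) (nbhs_filter z) (@l2norm R n) (l2norm z)) => //.
  exact: l2norm_continuous.
pose e := Num.min (r / 2) (r1 / 2).
have e0 : 0 < e by rewrite lt_min !divr_gt0.
have er : e <= r / 2 by rewrite ge_min lexx.
have er1 : e <= r1 / 2 by rewrite ge_min lexx orbT.
have haz : \forall i \near F, exists2 y, `|y - z| <= e & peval (qs i) y = 0.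
  exact: (approx_zero sqs sq cq hq q0 qz e0).
have [i [[h1 h2] [y hy qy]]] := filter_ex (filterI (filterI hr (hnear _ e0)) haz).
have yrad : l2norm y < rad.
  apply: hr1; rewrite mx_norm_ball /ball_ /= distrC; apply: le_lt_trans hy _.
  by apply: le_lt_trans er1 _; lra.
have [b pb hb] := h2 y qy yrad.
suff : peval (ps i) b != 0 by rewrite pb eqxx.
apply: h1; have -> : b - z = (y - z) - (y - b) by apply/rowP => k; rewrite !mxE; ring.
apply: (le_lt_trans (ler_normB _ _)).
by have := norm_le_l2norm (y - b); move: hy hb er; clear; move=> *; lra.
Qed.

End Limits.


(** * Dilations, blow-up at the origin and compactness *)
Section Rescaling.
Context {R : realType} {n : nat}.
Implicit Types (p q : mpoly.mpoly n R) (x y z v : 'rV[R]_n).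

Definition weighted (w : nat -> R) p : mpoly.mpoly n R :=
  poly_of_coefs (mpoly.msize p) (fun m => w (mdeg m) * cf m p).

Lemma mcoeff_weighted w p m : cf m (weighted w p) = w (mdeg m) * cf m p.
Proof.
rewrite mcoeff_poly_of_coefs; case: ifPn => //; rewrite -leqNgt => hm.
have /msize_le_coef hc := leqnn (mpoly.msize p).
by rewrite (hc _ hm) mulr0.
Qed.

Lemma msize_weighted w p D : (mpoly.msize p <= D)%N -> (mpoly.msize (weighted w p) <= D)%N.
Proof. by apply: leq_trans; exact: msize_poly_of_coefs. Qed.

Lemma harmonic_weighted w p : harmonic_poly p -> harmonic_poly (weighted w p).
Proof. by apply: harmonic_degree_weight => m; exact: mcoeff_weighted. Qed.

Lemma peval_weighted w p (a t : R) x :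
  (forall m, cf m p != 0 -> w (mdeg m) * a = t ^+ mdeg m) ->
  peval (weighted w p) x * a = peval p (t *: x).
Proof.
move=> hw; rewrite (peval_sum x (msize_weighted w (leqnn _))).
rewrite (peval_sum (t *: x) (leqnn (mpoly.msize p))) mulr_suml.
apply: eq_bigr => m _; rewrite mcoeff_weighted.
have [->|c0] := eqVneq (cf m p) 0; first by rewrite mulr0 !mul0r.
have -> : \prod_(i < n) (t *: x) 0 i ^+ (m : mon n) i =
    t ^+ mdeg m * \prod_(i < n) x 0 i ^+ (m : mon n) i.
  rewrite mpoly.mdegE -prodrXr -big_split; apply: eq_bigr => i _.
  by rewrite mxE exprMn.
by rewrite -(hw _ c0); ring.
Qed.

Definition dilate (t : R) p := weighted (fun i => t ^+ i) p.

Lemma peval_dilate t p x : peval (dilate t p) x = peval p (t *: x).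
Proof.
by rewrite -[LHS]mulr1; apply: peval_weighted => m _; rewrite mulr1.
Qed.

Lemma dilate_neq0 t p : t != 0 -> p != 0 -> dilate t p != 0.
Proof.
move=> t0 /neq0_coef[m hm]; apply/eqP => /(congr1 (cf m)); rewrite mcoeff_weighted.
by move/eqP; rewrite mpoly.mcoeff0 mulf_eq0 expf_eq0 (negbTE t0) andbF (negbTE hm).
Qed.

(** For polynomials vanishing at 0, being nonzero and being nonconstant are
    the same. *)
Definition admissible d p :=
  [/\ p != 0, harmonic_poly p, (mpoly.msize p <= d.+1)%N & peval p 0 = 0].

Lemma admissible_dilate d t p : t != 0 -> admissible d p -> admissible d (dilate t p).
Proof.
move=> t0 [p0 hp sp p00]; split; first exact: dilate_neq0.
- exact: harmonic_weighted.
- exact: msize_weighted.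
- by rewrite peval_dilate scaler0.
Qed.

Lemma admissibleZ d (a : R) p : a != 0 -> admissible d p -> admissible d (a *: p).
Proof.
move=> a0 [p0 hp sp p00]; split.
- by rewrite scaler_eq0 negb_or a0.
- by rewrite /harmonic_poly laplacianZ hp scaler0.
- by rewrite (leq_trans (mpoly.msizeZ_le _ _)).
- by rewrite pevalZ p00 mulr0.
Qed.

(** Dividing [p(x / (i + 1))] by its natural size, the power of [1 / (i + 1)]
    whose exponent is the order of vanishing at 0, leaves the lowest-order part
    in the limit. *)
Lemma lowest_part p D : harmonic_poly p -> p != 0 -> (mpoly.msize p <= D)%N ->
  exists j p0 (ps : nat -> mpoly.mpoly n R),
  [/\ exists2 m, cf m p != 0 & mdeg m = j,
      [/\ harmonic_poly p0, p0 != 0, homog p0 j & (mpoly.msize p0 <= D)%N],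
      (forall i, (mpoly.msize (ps i) <= D)%N), coef_cvg \oo ps p0
    & forall i x, peval (ps i) x = 0 <-> peval p (i.+1%:R^-1 *: x) = 0].
Proof.
move=> hp p0 sp.
have ex : exists j, `[< exists2 m, cf m p != 0 & mdeg m = j >].
  by have [m hm] := neq0_coef p0; exists (mdeg m); apply/asboolP; exists m.
case: (ex_minnP ex) => j /asboolP[m0 hm0 dm0] jmin.
have {}jmin m : cf m p != 0 -> (j <= mdeg m)%N.
  by move=> hm; apply: jmin; apply/asboolP; exists m.
pose w (i k : nat) : R := if (k < j)%N then 0 else i.+1%:R^-1 ^+ (k - j).
exists j, (weighted (fun k => (k == j)%:R) p), (fun i => weighted (w i) p).
split.
- by exists m0.
- split.
  + exact: harmonic_weighted.
  + apply/eqP => /(congr1 (cf m0)); rewrite mcoeff_weighted dm0 eqxx mul1r.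
    by rewrite mpoly.mcoeff0; exact/eqP.
  + move=> m; rewrite mcoeff_weighted; have [//|_] := eqVneq (mdeg m) j.
    by rewrite mul0r eqxx.
  + exact: msize_weighted.
- by move=> i; exact: msize_weighted.
- move=> m; under eq_fun do rewrite mcoeff_weighted; rewrite mcoeff_weighted.
  apply: cvgMr_tmp; rewrite /w; case: ltngtP => hj.
  + exact: cvg_cst.
  + have -> : (false%:R : R) = 0 ^+ (mdeg m - j) by rewrite expr0n subn_eq0 leqNgt hj.
    apply: (@cvg_comp _ _ _ (fun i : nat => i.+1%:R^-1 : R) (fun t => t ^+ (mdeg m - j))).
      exact: cvg_harmonic.
    exact: exprn_continuous.
  + by rewrite hj subnn; under eq_fun do rewrite expr0; exact: cvg_cst.
- move=> i x.
  have i0 : (i.+1%:R^-1 : R) ^+ j != 0 by rewrite expf_eq0 invr_eq0 pnatr_eq0 andbF.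
  rewrite -(@peval_weighted (w i) p (i.+1%:R^-1 ^+ j)); last first.
    move=> m /jmin hm; rewrite /w ltnNge hm /= -exprD subnK //.
  split=> [->|/eqP]; first by rewrite mul0r.
  by rewrite mulf_eq0 (negbTE i0) orbF => /eqP.
Qed.

(** Blowing up at 0 turns the inclusion of zeros in a ball into one on the
    whole space between the lowest-order parts, whose degrees are greater
    than [k] for [p] and at most [k] for [q]. *)
Lemma zeros_not_included_of_order p q k : harmonic_poly p -> p != 0 ->
  (forall m, cf m p != 0 -> (k < mdeg m)%N) -> admissible k q ->
  (forall z, l2norm z < 1 -> peval p z = 0 -> peval q z = 0) -> False.
Proof.
move=> hp p0 ordp [q0 hq sq q00] zpq.
pose D := maxn (mpoly.msize p) (mpoly.msize q).
have [j [pj [ps [[mp mp1 mp2] [hpj pj0 homp spj] sps cps zps]]]] :=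
  lowest_part hp p0 (leq_maxl _ _ : (mpoly.msize p <= D)%N).
have [m [qm [qs [[mq mq1 mq2] [hqm qm0 homq sqm] sqs cqs zqs]]]] :=
  lowest_part hq q0 (leq_maxr _ _ : (mpoly.msize q <= D)%N).
have kj : (k < j)%N by rewrite -mp2 ordp.
have mk' : (m <= k)%N.
  rewrite -mq2 leqNgt; apply/negP => h; case/negP: mq1; apply/eqP.
  by have /msize_le_coef := sq; apply.
have m0 : (0 < m)%N.
  rewrite -mq2 lt0n mpoly.mdeg_eq0; apply: contraNneq mq1 => ->.
  by rewrite -peval_at0 q00.
have zpjqm z : peval pj z = 0 -> peval qm z = 0.
  move=> hz; apply: (@zeros_near_lim R n nat \oo _ D qs ps qm pj (l2norm z + 1) z) => //;
    last by rewrite ltrDl.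
  move=> e e0; near=> i => a pa arad; exists a; last by rewrite subrr l2norm0.
  apply/zqs; apply: zpq; last exact/zps.
  rewrite l2normZ normfV normr_nat mulrC ltr_pdivrMr // mul1r.
  apply: (lt_le_trans arad); apply: (@le_trans _ _ i%:R); last by rewrite ler_nat.
  near: i; exact: nbhs_infty_ger.
have qm00 : peval qm 0 = 0.
  rewrite peval_at0; apply/eqP; apply: contrapT => /negP /homq.
  by rewrite mpoly.mdeg0 => h; rewrite -h in m0.
have [x1 _ qx1] := sign_change hqm qm0 qm00 ltr01.
have px1 : peval pj x1 != 0.
  by apply: contraTneq qx1 => /zpjqm ->; rewrite ltxx.
have homZ (a : R) f l : homog f l -> homog (a *: f) l.
  by move=> hf i; rewrite mpoly.mcoeffZ mulf_eq0 negb_or => /andP[_ /hf].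
have harZ (a : R) f : harmonic_poly f -> harmonic_poly (a *: f).
  by move=> hf; rewrite /harmonic_poly laplacianZ hf scaler0.
(* the signs make both polynomials positive at x1 *)
apply: (@homog_zeros_not_included R n (Num.sg (peval pj x1) *: pj) (-1 *: qm) j m x1).
- exact: harZ.
- exact: harZ.
- exact: homZ.
- exact: homZ.
- exact: leq_ltn_trans mk' kj.
- move=> x; rewrite !pevalZ => /eqP; rewrite mulf_eq0 sgr_eq0 (negbTE px1) /=.
  by move=> /eqP/zpjqm ->; rewrite mulr0.
- by rewrite pevalZ -normrEsg normr_gt0.
- by rewrite pevalZ mulN1r oppr_gt0.
Unshelve. all: by end_near.
Qed.

Lemma ex_ultra_nat : exists2 U : set_system nat, UltraFilter U & \oo `<=` U.
Proof.
have [U [UU sU]] := ultraFilterLemma (@eventually_filter).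
by exists U.
Qed.

Lemma ultra_natSinv_lt (U : set_system nat) (e : R) : \oo `<=` U -> 0 < e ->
  \forall i \near U, i.+1%:R^-1 < e.
Proof.
move=> sU e0; apply: sU.
exact: (near_infty_natSinv_lt (PosNum e0)).
Qed.

Lemma norm1_normalized D p : (mpoly.msize p <= D)%N -> p != 0 ->
  norm1 D ((norm1 D p)^-1 *: p) = 1.
Proof.
move=> sp p0; have h := norm1_gt0 sp p0.
by rewrite norm1Z normfV gtr0_norm // mulVf ?gt_eqF.
Qed.

(** If not, normalized counterexamples with constants tending to 0 converge to
    a polynomial without low part, whose zeros in the unit ball are zeros of a
    nonzero polynomial of degree at most [k]. *)
Lemma low_part_dominates k d : (k <= d)%N -> exists2 phi : R, 0 < phi &
  forall p q, admissible d p -> admissible k q -> zeros_near p q 1 phi ->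
  phi * norm1 d.+1 p <= norm1 k.+1 p.
Proof.
move=> kd; apply: contrapT => hneg.
have pq_ex : forall i : nat, exists pq : mpoly.mpoly n R * mpoly.mpoly n R,
    [/\ admissible d pq.1, admissible k pq.2, zeros_near pq.1 pq.2 1 i.+1%:R^-1
      & norm1 k.+1 pq.1 < i.+1%:R^-1 * norm1 d.+1 pq.1].
  move=> i; apply: contrapT => h; apply: hneg; exists i.+1%:R^-1.
    by rewrite invr_gt0.
  move=> p q vp vq hz; rewrite leNgt; apply/negP => hlt.
  by apply: h; exists (p, q).
have [pq hpq] := choice pq_ex.
have [U UU sU] := ex_ultra_nat.
pose a i := (norm1 d.+1 (pq i).1)^-1; pose b i := (norm1 d.+1 (pq i).2)^-1.
pose ps i := a i *: (pq i).1; pose qs i := b i *: (pq i).2.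
have a0 i : 0 < a i.
  by have [[p0 _ sp _] _ _ _] := hpq i; rewrite invr_gt0 norm1_gt0.
have sq' i : (mpoly.msize (pq i).2 <= d.+1)%N.
  by have [_ [_ _ sq _] _ _] := hpq i; apply: leq_trans sq _.
have b0 i : 0 < b i.
  by have [_ [q0 _ sq _] _ _] := hpq i; rewrite invr_gt0 norm1_gt0.
have vps i : admissible d (ps i).
  by have [vp _ _ _] := hpq i; apply: admissibleZ => //; rewrite gt_eqF.
have vqs i : admissible k (qs i).
  by have [_ vq _ _] := hpq i; apply: admissibleZ => //; rewrite gt_eqF.
have sps i : (mpoly.msize (ps i) <= d.+1)%N by have [] := vps i.
have sqs i : (mpoly.msize (qs i) <= d.+1)%N.
  by rewrite (leq_trans (mpoly.msizeZ_le _ _)).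
have [|P [sP cP P0]] := @poly_ultra_lim R n nat U UU d.+1 ps sps.
  by move=> i; have [[p0 _ sp _] _ _ _] := hpq i; exact: norm1_normalized.
have [|Q [sQ cQ Q0]] := @poly_ultra_lim R n nat U UU d.+1 qs sqs.
  by move=> i; have [_ [q0 _ sq _] _ _] := hpq i; exact: norm1_normalized.
have hP : harmonic_poly P by apply: (harmonic_lim cP) => i; have [] := vps i.
have hQ : harmonic_poly Q by apply: (harmonic_lim cQ) => i; have [] := vqs i.
have cst0 (f : nat -> R) l : (forall i, f i = 0) -> f @ U --> l -> l = 0.
  move=> f0 hf; have : f @ U --> (0 : R).
    by under [f]eq_fun do rewrite f0; exact: cvg_cst.
  by move=> hf'; exact: (cvg_unique _ hf hf').
apply: (@zeros_not_included_of_order P Q k hP P0).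
- move=> m; apply: contraNT; rewrite -leqNgt => mk'.
  suff nP : norm1 k.+1 P = 0 by apply/eqP; exact: (norm1_eq0 nP).
  apply/eqP; apply: contrapT => /negP nP.
  have {}nP : 0 < norm1 k.+1 P by rewrite lt_neqAle eq_sym nP norm1_ge0.
  have cn : norm1 k.+1 (ps i) @[i --> U] --> norm1 k.+1 P by exact: norm1_cvg.
  have h1 : \forall i \near U, norm1 k.+1 P / 2 < norm1 k.+1 (ps i).
    by apply: (cvgr_gt _ cn); lra.
  have h2 := ultra_natSinv_lt sU (divr_gt0 nP (ltr0n R 2)).
  have [i [i1 i2]] := filter_ex (filterI h1 h2); move: i1 i2 => /= i1 i2.
  have [_ _ _ hi] := hpq i.
  suff h : norm1 k.+1 (ps i) < i.+1%:R^-1.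
    by have := lt_trans (lt_trans h i2) i1; rewrite ltxx.
  rewrite norm1Z gtr0_norm // /a mulrC ltr_pdivrMr //.
  by rewrite -invr_gt0; exact: a0.
- split=> //.
    apply/msize_le_coef => m hm; apply: (cst0 _ _ _ (cQ m)) => i.
    by have [_ _ /msize_le_coef h _] := vqs i; exact: h.
  have : peval (qs i) 0 @[i --> U] --> peval Q 0.
    by apply: (cvg_peval sqs sQ cQ); exact: cvg_cst.
  by apply: cst0 => i; have [] := vqs i.
- move=> z zrad Pz; apply: (@zeros_near_lim R n nat U _ d.+1 qs ps Q P 1 z) => //.
  move=> e e0; have := ultra_natSinv_lt sU e0; apply: filterS => i hi x.
  rewrite pevalZ => /eqP; rewrite mulf_eq0 gt_eqF //= => /eqP px xrad.
  have [_ _ hz _] := hpq i; have [y qy xy] := hz x px xrad.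
  by exists y; [rewrite pevalZ qy mulr0 | exact: lt_trans hi].
Qed.

Lemma zeros_near_dilate (t rad e : R) p q p' q' : 0 < t ->
  (forall x, peval p' x = 0 <-> peval p (t *: x) = 0) ->
  (forall x, peval q' x = 0 <-> peval q (t *: x) = 0) ->
  zeros_near p' q' rad e -> zeros_near p q (rad * t) (e * t).
Proof.
move=> t0 hp hq hz a pa ha.
have tK x : t *: (t^-1 *: x) = x by rewrite scalerA mulfV ?scale1r // gt_eqF.
have [||b qb hb] := hz (t^-1 *: a).
- by apply/hp; rewrite tK.
- by rewrite l2normZ normfV gtr0_norm // mulrC ltr_pdivrMr.
exists (t *: b); first exact/hq.
by rewrite -[a]tK -scalerBr l2normZ gtr0_norm // mulrC ltr_pM2r.
Qed.

(** Zeros of the [ps i] that stay away from those of [p] would accumulate at a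
    zero of [p]. *)
Lemma eventually_zeros_near_lim (U : set_system nat) {UU : UltraFilter U} D
    (ps : nat -> mpoly.mpoly n R) p (e : R) : 0 < e ->
  (forall i, (mpoly.msize (ps i) <= D)%N) -> (mpoly.msize p <= D)%N -> coef_cvg U ps p ->
  \forall i \near U, zeros_near (ps i) p 1 e.
Proof.
move=> e0 sps sp cp.
have [//|bad] := in_ultra_setVsetC [set i | zeros_near (ps i) p 1 e] UU.
have a_ex : forall i, exists a : 'rV[R]_n, l2norm a < 1 /\
    (~ zeros_near (ps i) p 1 e ->
      peval (ps i) a = 0 /\ forall b, peval p b = 0 -> e <= l2norm (a - b)).
  move=> i; have [h|] := pselect (zeros_near (ps i) p 1 e).
    by exists 0; rewrite l2norm0.
  move=> h; apply: contrapT => hno; apply: h => a pa ra; apply: contrapT => hb.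
  apply: hno; exists a; split=> // _; split=> // b qb; rewrite leNgt; apply/negP => hlt.
  by apply: hb; exists b.
have [a ha] := choice a_ex.
have [i|l _ al] := @ultra_cvg _ U UU 'rV[R]_n _ a (@box_compact R n 0 1).
  rewrite /= subr0; apply: ltW; apply: le_lt_trans (norm_le_l2norm _) _.
  by have [] := ha i.
have pl : peval p l = 0.
  have c1 : peval (ps i) (a i) @[i --> U] --> peval p l by exact: (cvg_peval sps sp cp).
  apply/eqP; apply: contrapT => /negP h.
  have [i [i1 i2]] := filter_ex (filterI bad (cvgr_neq0 _ c1 h)).
  have [_ /(_ i1)[pa _]] := ha i.
  by rewrite pa eqxx in i2.
have c2 : l2norm (a i - l) @[i --> U] --> (0 : R).
  rewrite -[X in _ --> X](@l2norm0 R n) -(subrr l).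
  apply: (@cvg_comp _ _ _ (fun i => a i - l) (@l2norm R n)); last exact: l2norm_continuous.
  by apply: cvgB => //; exact: cvg_cst.
have h3 : \forall i \near U, l2norm (a i - l) < e by exact: (cvgr_lt _ c2).
have [i [i1 i2]] := filter_ex (filterI bad h3). move: i1 i2 => /= i1 i2.
have [_ /(_ i1)[_ /(_ l pl)]] := ha i.
by rewrite leNgt i2.
Qed.

(** Unlike the converse inclusion this needs harmonicity: a limit could have
    zeros that its approximations lack, were it not for [approx_zero]. *)
Lemma eventually_lim_zeros_near (U : set_system nat) {UU : UltraFilter U} D
    (ps : nat -> mpoly.mpoly n R) p (e : R) : 0 < e ->
  (forall i, (mpoly.msize (ps i) <= D)%N) -> (mpoly.msize p <= D)%N -> coef_cvg U ps p ->
  harmonic_poly p -> p != 0 ->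
  \forall i \near U, zeros_near p (ps i) 1 e.
Proof.
move=> e0 sps sp cp hp p0.
have [//|bad] := in_ultra_setVsetC [set i | zeros_near p (ps i) 1 e] UU.
have a_ex : forall i, exists a : 'rV[R]_n, [/\ l2norm a < 1,
    peval p a = 0 \/ zeros_near p (ps i) 1 e &
    (~ zeros_near p (ps i) 1 e ->
      forall b, peval (ps i) b = 0 -> e <= l2norm (a - b))].
  move=> i; have [h|] := pselect (zeros_near p (ps i) 1 e).
    by exists 0; rewrite l2norm0; split=> //; right.
  move=> h; apply: contrapT => hno; apply: h => a pa ra; apply: contrapT => hb.
  apply: hno; exists a; split=> // [|_ b qb]; first by left.
  rewrite leNgt; apply/negP => hlt.
  by apply: hb; exists b.
have [a ha] := choice a_ex.
have [i|l _ al] := @ultra_cvg _ U UU 'rV[R]_n _ a (@box_compact R n 0 1).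
  rewrite /= subr0; apply: ltW; apply: le_lt_trans (norm_le_l2norm _) _.
  by have [] := ha i.
have pl : peval p l = 0.
  have c1 : peval p (a i) @[i --> U] --> peval p l.
    by apply: (@cvg_comp _ _ _ a (peval p)); [exact: al | exact: peval_continuous].
  apply/eqP; apply: contrapT => /negP h.
  have [i [i1 i2]] := filter_ex (filterI bad (cvgr_neq0 _ c1 h)).
  have [_ [pa|//] _] := ha i.
  by rewrite pa eqxx in i2.
pose r := e / (2 * (n%:R + 1)).
have n0 : 0 <= n%:R :> R by [].
have r0 : 0 < r by rewrite divr_gt0 // mulr_gt0 //; lra.
have h1 : \forall i \near U, exists2 y, `|y - l| <= r & peval (ps i) y = 0.
  exact: (approx_zero sps sp cp hp p0 pl r0).
have /cvgrPdist_lt /(_ r r0) h2 := al.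
have [i [[i1 i2] [y yl py]]] := filter_ex (filterI (filterI bad h2) h1).
exfalso; have [_ _ /(_ i1 y py)] := ha i; rewrite leNgt => /negP; apply.
apply: (le_lt_trans (l2norm_le _)).
have : `|a i - y| <= r + r.
  have -> : a i - y = - ((y - l) + (l - a i)) by apply/rowP => k; rewrite !mxE; ring.
  rewrite normrN; apply: (le_trans (ler_normD _ _)).
  by apply: lerD => //; exact: ltW.
move=> hay; apply: (@le_lt_trans _ _ (n%:R * (r + r))); first by rewrite ler_wpM2l.
have -> : n%:R * (r + r) = (n%:R / (n%:R + 1)) * e.
  by rewrite /r; field; rewrite gt_eqF //; lra.
by rewrite gtr_pMl // ltr_pdivrMr; lra.
Qed.

(** If not, dilate the counterexamples by their scales, which tend to 0, and
    normalize. The coefficients of degree greater than [k] are then at most a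
    constant times the scale, so the limit has degree at most [k]; the zeros
    of the dilated polynomials and of the limit are eventually close to each
    other, and the limit dilated back serves as [q]. *)
Lemma low_part_detectable k d (c e : R) : (k <= d)%N -> 0 < c -> 0 < e ->
  exists2 s0 : R, 0 < s0 & forall p, admissible d p ->
    c * norm1 d.+1 p <= norm1 k.+1 p -> forall s, 0 < s < s0 ->
    exists q, [/\ admissible k q, zeros_near p q s (e * s) & zeros_near q p s (e * s)].
Proof.
move=> kd c0 e0; apply: contrapT => hneg.
have ps_ex : forall i : nat, exists a : mpoly.mpoly n R * R,
    [/\ admissible d a.1, c * norm1 d.+1 a.1 <= norm1 k.+1 a.1,
        0 < a.2 < i.+1%:R^-1
      & forall q, admissible k q -> zeros_near a.1 q a.2 (e * a.2) ->
          zeros_near q a.1 a.2 (e * a.2) -> False].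
  move=> i; apply: contrapT => h; apply: hneg; exists i.+1%:R^-1.
    by rewrite invr_gt0.
  move=> p vp hc s hs; apply: contrapT => hq; apply: h; exists (p, s); split=> //.
  by move=> q vq h1 h2; apply: hq; exists q.
have [ps' hps] := choice ps_ex.
have [U UU sU] := ex_ultra_nat.
pose s i := (ps' i).2; pose p i := (ps' i).1.
have s_gt0 i : 0 < s i by have [_ _ /andP[]] := hps i.
have s0 i : s i != 0 by rewrite gt_eqF.
have s1 i : s i <= 1.
  have [_ _ /andP[_ h] _] := hps i; apply: ltW; apply: (lt_le_trans h).
  by rewrite invf_le1 // ler1n.
pose dp i := dilate (s i) (p i).
have vdp i : admissible d (dp i).
  by have [vp _ _ _] := hps i; exact: admissible_dilate.
pose a i := (norm1 d.+1 (dp i))^-1.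
have a_gt0 i : 0 < a i by have [h1 _ h2 _] := vdp i; rewrite invr_gt0 norm1_gt0.
have a0 i : a i != 0 by rewrite gt_eqF.
pose ps i := a i *: dp i.
have vps i : admissible d (ps i) by exact: admissibleZ.
have sps i : (mpoly.msize (ps i) <= d.+1)%N by have [] := vps i.
have [|P [sP cP P0]] := @poly_ultra_lim R n nat U UU d.+1 ps sps.
  by move=> i; have [h1 _ h2 _] := vdp i; exact: norm1_normalized.
have hP : harmonic_poly P by apply: (harmonic_lim cP) => i; have [] := vps i.
have P00 : peval P 0 = 0.
  have c1 : peval (ps i) 0 @[i --> U] --> peval P 0.
    by apply: (cvg_peval sps sP cP); exact: cvg_cst.
  have c2 : peval (ps i) 0 @[i --> U] --> (0 : R).
    have h0 i : peval (ps i) 0 = 0 by have [] := vps i.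
    by under eq_fun do rewrite h0; exact: cvg_cst.
  exact: (cvg_unique _ c1 c2).
(* each coefficient of the low part is bounded by the whole norm, which costs
   a factor equal to the number of monomials *)
pose N : R := #|{: mpoly.bmultinom n k.+1}|%:R.
have lowb i : s i ^+ k * (c * norm1 d.+1 (p i)) <= N * norm1 d.+1 (dp i).
  have [_ hc _ _] := hps i.
  apply: (@le_trans _ _ (s i ^+ k * norm1 k.+1 (p i))).
    by apply: ler_wpM2l => //; apply: exprn_ge0; exact: ltW (s_gt0 i).
  rewrite mulr_sumr /N mulr_natl -sumr_const; apply: ler_sum => m _.
  have mdeg_k : (mdeg m <= k)%N by rewrite -ltnS mpoly.bmdeg.
  apply: le_trans (coef_le_norm1 (dp i) (leq_ltn_trans mdeg_k (kd : (k < d.+1)%N))).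
  rewrite mcoeff_weighted normrM normrX (gtr0_norm (s_gt0 i)) ler_wpM2r //.
  by apply: ler_wiXn2l => //; exact: ltW (s_gt0 i).
have high i m : (k < mdeg m)%N -> `|cf m (ps i)| <= N / c * s i.
  move=> km; have [mdd|dm] := ltnP (mdeg m) d.+1; last first.
    have /msize_le_coef -> := sps i; rewrite // normr0 mulr_ge0 ?(ltW (s_gt0 i)) //.
    by rewrite divr_ge0 // ltW.
  rewrite mpoly.mcoeffZ mcoeff_weighted !normrM normrX (gtr0_norm (s_gt0 i)).
  rewrite (gtr0_norm (a_gt0 i)) /a ler_pdivrMl; last by rewrite -invr_gt0; exact: a_gt0.
  apply: (@le_trans _ _ (s i ^+ k.+1 * norm1 d.+1 (p i))).
    apply: ler_pM => //; first by apply: exprn_ge0; exact: ltW (s_gt0 i).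
      by apply: ler_wiXn2l => //; exact: ltW (s_gt0 i).
    exact: coef_le_norm1.
  have -> : s i ^+ k.+1 * norm1 d.+1 (p i) =
      s i / c * (s i ^+ k * (c * norm1 d.+1 (p i))).
    by rewrite exprS; field; rewrite gt_eqF.
  have -> : norm1 d.+1 (dp i) * (N / c * s i) = s i / c * (N * norm1 d.+1 (dp i)).
    by ring.
  by apply: ler_wpM2l => //; apply: divr_ge0; apply: ltW.
have vP : admissible k P.
  split=> //; apply/msize_le_coef => m km; apply/eqP; apply: contrapT => /negP Pm.
  have Pm0 : 0 < `|cf m P| by rewrite normr_gt0.
  have Nc : 0 < N / c + 1 by apply: ltr_wpDl => //; rewrite divr_ge0 // ltW.
  have h1 : \forall i \near U, `|cf m P| / 2 < `|cf m (ps i)|.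
    apply: (@cvgr_gt _ _ U _ (fun i => `|cf m (ps i)|) `|cf m P|); last by lra.
    by apply: cvg_norm; exact: cP.
  have h2 := ultra_natSinv_lt sU (divr_gt0 (divr_gt0 Pm0 (ltr0n R 2)) Nc).
  have [i [i1 i2]] := filter_ex (filterI h1 h2); move: i1 i2 => /= i1 i2.
  have h3 := high i m km.
  have si : s i <= i.+1%:R^-1 by have [_ _ /andP[_ /ltW]] := hps i.
  have : N / c * s i <= `|cf m P| / 2.
    apply: (@le_trans _ _ ((N / c + 1) * s i)).
      by rewrite mulrDl mul1r lerDl ltW.
    rewrite mulrC -ler_pdivlMr //; apply: (le_trans si); exact: ltW.
  by move: h3 i1; clear; move=> *; lra.
have n1 : \forall i \near U, zeros_near (ps i) P 1 e.
  exact: (eventually_zeros_near_lim e0 sps sP cP).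
have n2 : \forall i \near U, zeros_near P (ps i) 1 e.
  exact: (eventually_lim_zeros_near e0 sps sP cP hP P0).
have [i [i1 i2]] := filter_ex (filterI n1 n2).
have [_ _ _ hno] := hps i.
have eqp x : peval (ps i) x = 0 <-> peval (p i) (s i *: x) = 0.
  rewrite pevalZ peval_dilate; split=> [/eqP|->]; last by rewrite mulr0.
  by rewrite mulf_eq0 (negbTE (a0 i)) => /eqP.
have eqP' x : peval P x = 0 <-> peval (dilate (s i)^-1 P) (s i *: x) = 0.
  by rewrite peval_dilate scalerA mulVf // scale1r.
apply: (hno (dilate (s i)^-1 P)).
- by apply: admissible_dilate => //; rewrite invr_eq0.
- by rewrite -[X in zeros_near _ _ X _]mul1r; exact: (zeros_near_dilate (s_gt0 i) eqp eqP' i1).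
- by rewrite -[X in zeros_near _ _ X _]mul1r; exact: (zeros_near_dilate (s_gt0 i) eqP' eqp i2).
Qed.

End Rescaling.


(** * Bounds on Theta *)
Section ThetaBounds.
Context {R : realType} {n : nat}.
Implicit Types (p q : mpoly.mpoly n R) (x y z v a b : 'rV[R]_n) (A B S : set 'rV[R]_n).

Lemma translate0 S : translate 0 S = S.
Proof.
rewrite /translate; under eq_imagel do rewrite add0r.
exact: image_id.
Qed.

Lemma harmonic_zero_setsP d S : harmonic_zero_sets R n d S <->
  exists2 p, admissible d p & S = zero_set p.
Proof.
split=> [[p [hc hp sp p00] <-]|[p [p0 hp sp p00] ->]].
  exists p => //; split=> //; apply/eqP => p0; apply: (hc 0).
  by rewrite p0 mpoly.mpolyC0.
exists p => //; split=> // c pc; case/negP: p0; apply/eqP.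
by move: p00; rewrite pc pevalC => ->; rewrite mpoly.mpolyC0.
Qed.

Lemma l2dist_has_lbound a A : has_lbound [set l2norm (a - b) | b in A].
Proof. by exists 0 => _ [b _ <-]; exact: l2norm_ge0. Qed.

Lemma l2dist_le a b A : A b -> l2dist a A <= l2norm (a - b).
Proof. by move=> Ab; apply: ge_inf; [exact: l2dist_has_lbound | exists b]. Qed.

Lemma l2dist_ge0 a A : A 0 -> 0 <= l2dist a A.
Proof.
move=> A0; apply: lb_le_inf; first by exists (l2norm (a - 0)), 0.
by move=> _ [b _ <-]; exact: l2norm_ge0.
Qed.

Lemma l2dist_lt a A (e : R) : A 0 -> l2dist a A < e -> exists2 b, A b & l2norm (a - b) < e.
Proof.
move=> A0 h; have [|_ [b Ab <-] hb] := inf_lt _ h; last by exists b.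
by exists (l2norm (a - 0)), 0.
Qed.

Definition excess A B (r : R) : R := sup [set l2dist a B | a in A `&` l2ball 0 r].

Lemma excess_has_ubound A B r : B 0 -> has_ubound [set l2dist a B | a in A `&` l2ball 0 r].
Proof.
move=> B0; exists r => _ [a [_ ar] <-]; apply: le_trans (l2dist_le _ B0) _.
by rewrite ltW.
Qed.

Lemma excess_ge0 A B r : 0 < r -> A 0 -> B 0 -> 0 <= excess A B r.
Proof.
move=> r0 A0 B0; apply: le_trans (l2dist_ge0 0 B0) _.
apply: ub_le_sup; first exact: excess_has_ubound.
by exists 0 => //; split=> //; rewrite /l2ball /= subrr l2norm0.
Qed.

Lemma excess_le A B r (e : R) : 0 < r -> A 0 ->
  (forall a, A a -> l2norm a < r -> l2dist a B <= e) -> excess A B r <= e.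
Proof.
move=> r0 A0 h; apply: ge_sup.
  exists (l2dist 0 B), 0 => //; split=> //.
  by rewrite /l2ball /= subrr l2norm0.
by move=> _ [a [Aa ar] <-]; apply: h => //; move: ar; rewrite /l2ball /= subr0.
Qed.

Lemma le_excess A B r a : B 0 -> A a -> l2norm a < r -> l2dist a B <= excess A B r.
Proof.
move=> B0 Aa ar; apply: ub_le_sup; first exact: excess_has_ubound.
by exists a => //; split=> //; rewrite /l2ball /= subr0.
Qed.

Lemma ThetaE (T : set (set 'rV[R]_n)) A r : Theta T A 0 r =
  r^-1 * inf [set Num.max (excess A S r) (excess S A r) | S in T].
Proof.
rewrite /Theta; congr (_ * inf _); apply: eq_imagel => S _.
by rewrite translate0.
Qed.

Context (k : nat) (k0 : (0 < k)%N) (n0 : (0 < n)%N).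

Lemma admissible_exists : exists q : mpoly.mpoly n R, admissible k q.
Proof.
pose i0 : 'I_n := Ordinal n0.
exists (mpoly.mpolyX R (mpoly.mnm1 i0)); split.
- apply/eqP => /(congr1 (cf (U_ i0))); rewrite mpoly.mcoeffX eqxx mpoly.mcoeff0.
  by move/eqP; rewrite oner_eq0.
- by apply: big1 => i _; rewrite mderivU mpoly.mderivC.
- by rewrite mpoly.msizeX mpoly.mdeg1.
- by rewrite pevalU mxE.
Qed.

Lemma Theta_lt p r (e : R) : peval p 0 = 0 -> 0 < r ->
  Theta (harmonic_zero_sets R n k) (zero_set p) 0 r < e ->
  exists2 q, admissible k q & zeros_near p q r (e * r).
Proof.
move=> p00 r0; rewrite ThetaE mulrC ltr_pdivrMr // => h.
have [|_ [S /harmonic_zero_setsP[q vq ->] <-]] := inf_lt _ h.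
  have [q vq] := admissible_exists.
  exists (Num.max (excess (zero_set p) (zero_set q) r)
    (excess (zero_set q) (zero_set p) r)), (zero_set q) => //.
  by apply/harmonic_zero_setsP; exists q.
have q00 : peval q 0 = 0 by have [] := vq.
rewrite gt_max => /andP[hlt _]; exists q => // a pa ar.
have [|b qb hb] := @l2dist_lt a (zero_set q) (e * r) q00; last by exists b.
by apply: le_lt_trans hlt; exact: le_excess.
Qed.

Lemma Theta_le p q r (e : R) : peval p 0 = 0 -> 0 < r -> admissible k q ->
  excess (zero_set p) (zero_set q) r <= e * r ->
  excess (zero_set q) (zero_set p) r <= e * r ->
  Theta (harmonic_zero_sets R n k) (zero_set p) 0 r <= e.
Proof.
move=> p00 r0 vq h1 h2; rewrite ThetaE mulrC ler_pdivrMr //.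
apply: (@le_trans _ _ (Num.max (excess (zero_set p) (zero_set q) r)
    (excess (zero_set q) (zero_set p) r))); last by rewrite ge_max h1 h2.
apply: ge_inf; last first.
  by exists (zero_set q) => //; apply/harmonic_zero_setsP; exists q.
exists 0 => _ [S /harmonic_zero_setsP[f [_ _ _ f00] ->] <-].
by rewrite le_max excess_ge0.
Qed.

Lemma excess_zeros_near p q r (e : R) : peval p 0 = 0 -> 0 < r ->
  zeros_near p q r e -> excess (zero_set p) (zero_set q) r <= e.
Proof.
move=> p00 r0 h; apply: excess_le => // a pa ar; have [b qb hb] := h a pa ar.
by apply: le_trans (l2dist_le a qb) _; exact: ltW.
Qed.

(** Both zero sets contain the center of the ball. *)
Lemma Theta_le1 p r : peval p 0 = 0 -> 0 < r ->
  Theta (harmonic_zero_sets R n k) (zero_set p) 0 r <= 1.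
Proof.
move=> p00 r0; have [q vq] := admissible_exists.
have q00 : peval q 0 = 0 by have [] := vq.
apply: (Theta_le p00 r0 vq); rewrite mul1r; apply: excess_le => // a _ ar.
  by apply: le_trans (l2dist_le a (q00 : zero_set q 0)) _; rewrite subr0 ltW.
by apply: le_trans (l2dist_le a (p00 : zero_set p 0)) _; rewrite subr0 ltW.
Qed.

(** The scales [r] and [s * r] are reduced to 1 and [s] by dilating by [r]. *)
Lemma Theta_uniform d : (k <= d)%N -> exists2 phi : R, 0 < phi &
  forall e : R, 0 < e -> exists2 s0 : R, 0 < s0 &
  forall p r, admissible d p -> 0 < r ->
    Theta (harmonic_zero_sets R n k) (zero_set p) 0 r < phi ->
    forall s, 0 < s < s0 ->
    Theta (harmonic_zero_sets R n k) (zero_set p) 0 (s * r) <= e.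
Proof.
move=> kd; have [phi phi0 hphi] := @low_part_dominates R n k d kd.
exists phi => // e e0; have [s0 s00 hs0] := @low_part_detectable R n k d phi e kd phi0 e0.
exists s0 => // p r vp r0 hT s hs; have p00 : peval p 0 = 0 by have [] := vp.
have r_neq0 : r != 0 by rewrite gt_eqF.
have [q vq hq] := Theta_lt p00 r0 hT.
have dil f x : peval f x = 0 <-> peval (dilate r f) (r^-1 *: x) = 0.
  by rewrite peval_dilate scalerA mulfV // scale1r.
have vdp : admissible d (dilate r p) by exact: admissible_dilate.
have hq1 : zeros_near (dilate r p) (dilate r q) 1 phi.
  have ri : 0 < r^-1 by rewrite invr_gt0.
  have := zeros_near_dilate ri (dil p) (dil q) hq.
  by rewrite mulfV // mulfK.
have [f [vf f1 f2]] := hs0 _ vdp (hphi _ _ vdp (admissible_dilate r_neq0 vq) hq1) s hs.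
have dilf x : peval f x = 0 <-> peval (dilate r^-1 f) (r *: x) = 0.
  by rewrite peval_dilate scalerA mulVf // scale1r.
have dilp x : peval (dilate r p) x = 0 <-> peval p (r *: x) = 0.
  by rewrite peval_dilate.
have vf' : admissible k (dilate r^-1 f) by apply: admissible_dilate => //; rewrite invr_eq0.
have sr0 : 0 < s * r by case/andP: hs => ? _; rewrite mulr_gt0.
have f00 : peval (dilate r^-1 f) 0 = 0 by have [] := vf'.
apply: (Theta_le p00 sr0 vf'); rewrite mulrA; apply: excess_zeros_near => //.
  exact: (zeros_near_dilate r0 dilp dilf f1).
exact: (zeros_near_dilate r0 dilf dilp f2).
Qed.

End ThetaBounds.

Theorem corollary1p5 (R : realType) (n k d : nat)
  (hn : (2 <= n)%N) (hk : (1 <= k)%N) (hkd : (k < d)%N) :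
  detectable (harmonic_zero_sets R n k) (harmonic_zero_sets R n d).
Proof.
have n0 : (0 < n)%N by exact: leq_trans hn.
have [phi phi0 unif] := @Theta_uniform R n k hk n0 d (ltnW hkd).
pose Th S r := Theta (harmonic_zero_sets R n k) S 0 r.
(* 0 is added so that the supremum is over a nonempty set for every s *)
pose E (s : R) : set R := [set t | t = 0 \/ exists S r,
  [/\ harmonic_zero_sets R n d S, 0 < r, Th S r < phi & t = Th S (s * r)]].
have E0 s : E s !=set0 by exists 0; left.
have Eub s : 0 < s -> has_ubound (E s).
  move=> s0; exists 1 => t [->|[S [r [/harmonic_zero_setsP[p [_ _ _ p00] ->] r0 _ ->]]]] //.
  by apply: Theta_le1 => //; exact: mulr_gt0.
have sup0 s : 0 < s -> 0 <= sup (E s) by move=> s0; apply: ub_le_sup; [exact: Eub | left].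
pose Phi s := s + sup (E s).
exists phi, Phi; split=> //.
- by move=> s /andP[s0 _]; apply: ltr_wpDr => //; exact: sup0.
- have PhiE (e : R) : 0 < e -> exists2 s0 : R, 0 < s0 & forall s, 0 < s < s0 -> Phi s <= s + e.
    move=> e0; have [s0 s00 hs0] := unif e e0; exists s0 => // s hs.
    rewrite lerD2l; apply: ge_sup => // t [->|[S [r [/harmonic_zero_setsP[p vp ->] r0 hT ->]]]].
      exact: ltW.
    exact: hs0.
  rewrite limf_einfE; apply/eqP; rewrite eq_le; apply/andP; split.
    apply: ge_ereal_sup => _ [V FV <-].
    apply/lee_addgt0Pr => e e0; rewrite add0e.
    have [s0 s00 hs0] := PhiE (e / 2) ltac:(lra).
    have h1 : \forall s \near (0 : R)^'+, 0 < s by exact: nbhs_right_gt.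
    have h2 : \forall s \near (0 : R)^'+, s < Num.min s0 (e / 2).
      by apply: nbhs_right_lt; rewrite lt_min s00 divr_gt0.
    have [s [[Vs s_gt0] s_lt]] := filter_ex (filterI (filterI FV h1) h2).
    move: s_lt; rewrite lt_min => /andP[ss0 se].
    apply: (@le_trans _ _ (Phi s)%:E); first by apply: ereal_inf_lbound; exists s.
    rewrite lee_fin; apply: (le_trans (hs0 s _)); first by rewrite s_gt0.
    by move: se; clear; move=> *; lra.
  apply: le_ereal_sup_tmp.
  exists (ereal_inf ((fun s => (Phi s)%:E) @` [set s : R | 0 < s])).
    by exists [set s : R | 0 < s] => //; exact: nbhs_right_gt.
  apply: le_ereal_inf_tmp => _ [s /= s_gt0 <-].
  by rewrite lee_fin addr_ge0 ?sup0 // ltW.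
- move=> S r US r0 hT s /andP[s0 s1].
  apply: (@le_lt_trans _ _ (sup (E s))); last by rewrite ltrDr.
  by apply: ub_le_sup; [exact: Eub | right; exists S, r].
Qed.
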